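(* Let $N\ge1$ be an integer, let $k\ge6$ be an even integer, and let $f\in\mathcal{S}_k(\Gamma_0(N))$ be a newform of weight $k$ and level $N$. Let $\gamma=\begin{pmatrix}a&b\\c&d\end{pmatrix}\in\Gamma_0(N)$ with $c>0$ (so $\gamma\infty=a/c$). Then the period polynomial $r_{f,\gamma}$ is a polynomial of degree exactly $k-2$. Furthermore, every zero $x_0\in\mathbb{C}$ of $r_{f,\gamma}$ satisfies $$x_0=\frac ac+O_k\!\left(\Bigl(\Bigl|\frac ac\Bigr|+1\Bigr)^{(k-4)/(k-2)}c^{-2/(k-2)}\right),$$ where the implied constant depends only on $k$.
   Context: A newform is a Hecke-normalized (first Fourier coefficient equal to $1$) newform in the sense of Atkin--Lehner, with trivial nebentypus. For $f\in\mathcal{S}_k(\Gamma_0(N))$ and $\gamma\in\Gamma_0(N)$, the period polynomial of $f$ associated to $\gamma$ is $$r_{f,\gamma}(X)=\int_{\gamma\infty}^{\infty}f(z)(z-X)^{k-2}\,dz=\sum_{j=0}^{k-2}(-1)^j\binom{k-2}{j}X^j\int_{\gamma\infty}^{\infty}f(z)z^{k-2-j}\,dz,$$ the integrals being taken along the vertical line from the cusp $\gamma\infty$ to $i\infty$ in the upper half-plane. *)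

(* Defs.v *)
From Stdlib Require Export Reals ZArith List.
From Coquelicot Require Export Coquelicot.
Open Scope R_scope.

(* Forms on the upper half-plane are total functions [C -> C]; every condition
   below only concerns their values at points [z] with [0 < Im z]. *)

Definition Cexp (z : C) : C :=
  (exp (Re z) * cos (Im z), exp (Re z) * sin (Im z)).

Definition IZC (n : Z) : C := RtoC (IZR n).
Definition INC (n : nat) : C := RtoC (INR n).

(** * The modular group *)

Record mat2 := Mat2 { ma : Z; mb : Z; mc : Z; md : Z }.

Definition mat2_mul (g h : mat2) : mat2 :=
  Mat2 (ma g * ma h + mb g * mc h) (ma g * mb h + mb g * md h)
       (mc g * ma h + md g * mc h) (mc g * mb h + md g * md h).

Definition SL2Z (g : mat2) : Prop := (ma g * md g - mb g * mc g = 1)%Z.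

Definition Gamma0 (N : nat) (g : mat2) : Prop :=
  SL2Z g /\ (Z.of_nat N | mc g)%Z.

Definition automorphy (g : mat2) (z : C) : C := (IZC (mc g) * z + IZC (md g))%C.

Definition moebius (g : mat2) (z : C) : C :=
  ((IZC (ma g) * z + IZC (mb g)) / automorphy g z)%C.

Definition slash (k : nat) (f : C -> C) (g : mat2) (z : C) : C :=
  (f (moebius g z) / automorphy g z ^ k)%C.

(** * Cusp forms *)

Definition holomorphic_on_H (f : C -> C) : Prop :=
  forall z : C, 0 < Im z -> ex_derive (K := C_AbsRing) (V := C_NormedModule) f z.

(* [f z = sum_(n >= 0) a_n exp (2 pi i n z / h)] on the upper half-plane. *)
Definition fourier_expansion (h : nat) (f : C -> C) (a : nat -> C) : Prop :=
  forall z : C, 0 < Im z ->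
    is_series (K := C_AbsRing) (V := C_NormedModule)
      (fun n => (a n * Cexp (2 * PI * Ci * INC n * z / INC h))%C) (f z).

(* For every [g] in SL2(Z), [f] slashed by [g] is invariant under the principal
   congruence subgroup of level [N], hence under [z |-> z + N]: its expansion is
   in powers of [exp (2 pi i z / N)], and vanishing at the cusp [g oo] means
   that only positive powers occur. *)
Definition cusp_form (N k : nat) (f : C -> C) : Prop :=
  holomorphic_on_H f /\
  (forall (g : mat2) (z : C), Gamma0 N g -> 0 < Im z -> slash k f g z = f z) /\
  (forall g : mat2, SL2Z g ->
     exists a : nat -> C, a 0%nat = 0 /\ fourier_expansion N (slash k f g) a).

(** * Petersson product *)

(* Integral of [phi] over the standard fundamental domain
   [|x| <= 1/2, x^2 + y^2 >= 1] of SL2(Z), for the measure [dx dy / y^2]. *)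
Definition integral_fund_domain (phi : C -> C) : C :=
  RInt (V := C_R_CompleteNormedModule)
    (fun x : R =>
       RInt_gen (V := C_R_CompleteNormedModule)
         (fun y : R => (phi (x, y) / RtoC (y ^ 2))%C)
         (at_point (sqrt (1 - x ^ 2))) (Rbar_locally p_infty))
    (- (1 / 2)) (1 / 2).

Definition coset_representatives (N : nat) (l : list mat2) : Prop :=
  NoDup l /\ (forall s, In s l -> SL2Z s) /\
  (forall g, SL2Z g ->
     exists! s, In s l /\ exists h, Gamma0 N h /\ g = mat2_mul h s).

(* Petersson product over [Gamma0 N \ H], unnormalized by the volume, computed
   on the fundamental domain of [Gamma0 N] given by coset representatives [l]. *)
Definition petersson (k : nat) (l : list mat2) (f g : C -> C) : C :=
  let phi z := (f z * Cconj (g z) * RtoC (Im z ^ k))%C in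
  fold_right Cplus 0
    (map (fun s => integral_fund_domain (fun z => phi (moebius s z))) l).

(* For [f] and [g] cusp forms on [Gamma0 N], the product does not depend on
   [l], and such an [l] exists since [Gamma0 N] has finite index. *)
Definition petersson_orthogonal (N k : nat) (f g : C -> C) : Prop :=
  forall l, coset_representatives N l -> petersson k l f g = 0.

(** * Newforms *)

Inductive oldform (N k : nat) : (C -> C) -> Prop :=
| oldform_lift (M d : nat) (g : C -> C) :
    (M < N)%nat -> Nat.divide (M * d) N -> cusp_form M k g ->
    oldform N k (fun z => g (INC d * z)%C)
| oldform_zero : oldform N k (fun _ => RtoC 0)
| oldform_plus (g h : C -> C) :
    oldform N k g -> oldform N k h -> oldform N k (fun z => (g z + h z)%C)
| oldform_scal (c : C) (g : C -> C) :
    oldform N k g -> oldform N k (fun z => (c * g z)%C).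

(* [T_n f (z) = n^(k-1) * sum_(a d = n, gcd(a, N) = 1) d^(-k) *
   sum_(0 <= b < d) f ((a z + b) / d)]; for [n] a prime dividing [N] this is
   the operator [U_n]. *)
Definition hecke (N k n : nat) (f : C -> C) (z : C) : C :=
  (INC n ^ (k - 1) *
   sum_n_m (G := C_AbelianMonoid)
     (fun d =>
        if andb (Nat.eqb (n mod d) 0) (Nat.eqb (Nat.gcd (n / d) N) 1)
        then (/ INC d ^ k *
              sum_n_m (G := C_AbelianMonoid)
                (fun b => f ((INC (n / d) * z + INC b) / INC d)%C)
                0 (d - 1))%C
        else RtoC 0)
     1 n)%C.

Definition hecke_eigenform (N k : nat) (f : C -> C) : Prop :=
  forall n : nat, (1 <= n)%nat ->
    exists lambda : C, forall z : C, 0 < Im z -> hecke N k n f z = (lambda * f z)%C.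

Definition newform (N k : nat) (f : C -> C) : Prop :=
  cusp_form N k f /\
  (forall g, oldform N k g -> petersson_orthogonal N k f g) /\
  hecke_eigenform N k f /\
  (exists a : nat -> C, fourier_expansion 1 f a /\ a 1%nat = 1).

(** * Period polynomials *)

(* Integral of [F z dz] along the vertical line from the real point [x] to
   [i oo], parametrized by [z = x + i t]. *)
Definition vertical_integral (x : R) (F : C -> C) : C :=
  RInt_gen (V := C_R_CompleteNormedModule)
    (fun t : R => (F (x, t) * Ci)%C) (at_right 0) (Rbar_locally p_infty).

(* Only meant for [mc g <> 0], where [g oo] is the real number [ma g / mc g]. *)
Definition period_polynomial (k : nat) (f : C -> C) (g : mat2) (X : C) : C :=
  vertical_integral (IZR (ma g) / IZR (mc g))
    (fun z => (f z * (z - X) ^ (k - 2))%C).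

Definition polynomial_of_degree (n : nat) (P : C -> C) : Prop :=
  exists p : nat -> C, p n <> 0 /\
    forall X : C,
      P X = sum_n (G := C_AbelianMonoid) (fun j => (p j * X ^ j)%C) n.

(* Main.v *)
(** Write [k = 2 l] and [w = k - 2]. As [f] is a cusp form, [|f z| (Im z)^l] is
    bounded on the upper half-plane; comparing its supremum with that of
    [T_n f = a_n f] gives [|a_n| <= n^(l-1) sigma(n)] with no implied constant.
    Since [l >= 3], [sum_(n >= 2) |a_n| n^(1-k) <= zeta(2) zeta(3) - 1 < 1], so in
    the moment of order [w] of [f] along any vertical line the term [n = 1]
    dominates: the moment is bounded above and below, uniformly in [N] and [f].
    The substitution [t -> 1 / (c^2 t)], i.e. the action of [gamma], turns this
    into [|int f(a/c + it) dt| ~ c^w], while [int |f(a/c + it)| t^w dt = O(1)].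
    The first integral is, up to a unit, the leading coefficient of [r], and the
    two estimates leave no zero at distance [>> 1 / c] from [a / c], which is
    stronger than the claim. *)

Require Import Defs.
From Stdlib Require Import Lra Lia Psatz Classical.
Open Scope R_scope.

(** * Fourier expansions *)

(** The numerical margin is thin and fixes the constants. Write [W] for the integral of
    [exp (- 2 pi u) u^w] over [(0, oo)]. The terms [n >= 2] take at most [0.983 W], so a lower bound
    [0.017 W] survives. Replacing [(z - X)^w] by [(x - X)^w] when [|X - x| >= s / c] costs a
    relative error [4 * 2^w / s], and [s = 250 * 2^w] makes it [0.016 < 0.017]. Infinite sums and
    improper integrals are never interchanged. Every estimate is made on a compact [[e, r]] inside
    [(0, oo)], with the Fourier series cut at a finite order, and with bounds that depend neither on
    [e], [r] nor on the order; limits are taken only at the end. The full Fourier expansion of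
    [T_n f] is not computed either: to identify the eigenvalue with [a n] it suffices to know
    [T_n f (iy)] up to [o(exp (- 2 pi y))]. *)

Lemma Cmod_Cexp (z : C) : Cmod (Cexp z) = exp (Re z).
Proof.
  unfold Cexp, Cmod; simpl.
  replace (exp (Re z) * cos (Im z) * (exp (Re z) * cos (Im z) * 1) +
           exp (Re z) * sin (Im z) * (exp (Re z) * sin (Im z) * 1))
    with (exp (Re z) ^ 2 * ((sin (Im z))² + (cos (Im z))²)) by (unfold Rsqr; ring).
  rewrite sin2_cos2, Rmult_1_r. apply sqrt_pow2, Rlt_le, exp_pos.
Qed.

Lemma Cexp_plus (z w : C) : Cexp (z + w) = (Cexp z * Cexp w)%C.
Proof.
  destruct z as [x y], w as [u v]; unfold Cexp, Cmult, Cplus; simpl.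
  rewrite exp_plus, cos_plus, sin_plus. f_equal; ring.
Qed.

Lemma Cexp_0 : Cexp 0 = 1.
Proof. unfold Cexp; simpl. rewrite exp_0, cos_0, sin_0. unfold RtoC. f_equal; ring. Qed.

Lemma Cexp_nat_mult (n : nat) (z : C) : Cexp (INC n * z) = (Cexp z ^ n)%C.
Proof.
  induction n as [|n IH].
  - unfold INC; simpl INR. rewrite Cmult_0_l. apply Cexp_0.
  - rewrite Cpow_S, <- IH, <- Cexp_plus. f_equal.
    unfold INC. rewrite S_INR, RtoC_plus. ring.
Qed.

Lemma INC_neq_0 (n : nat) : (1 <= n)%nat -> INC n <> RtoC 0.
Proof.
  intros Hn H. apply RtoC_inj in H. apply (not_0_INR n); [lia | exact H].
Qed.

Definition qexp (h : nat) (z : C) : C := Cexp (2 * PI * Ci * z / INC h).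

Lemma fourier_char (h n : nat) (z : C) :
  Cexp (2 * PI * Ci * INC n * z / INC h) = (qexp h z ^ n)%C.
Proof.
  unfold qexp. rewrite <- Cexp_nat_mult. f_equal. unfold Cdiv. ring.
Qed.

Lemma INC_inv (h : nat) : (1 <= h)%nat -> Cinv (INC h) = RtoC (/ INR h).
Proof. intros Hh. unfold INC. rewrite RtoC_inv. reflexivity. apply not_0_INR; lia. Qed.

Lemma Cmod_qexp (h : nat) (z : C) :
  (1 <= h)%nat -> Cmod (qexp h z) = exp (- (2 * PI * Im z / INR h)).
Proof.
  intros Hh. unfold qexp. rewrite Cmod_Cexp. f_equal.
  unfold Cdiv. rewrite INC_inv by exact Hh. destruct z as [x y]. simpl. field.
  apply not_0_INR; lia.
Qed.

Lemma exp_monotone (x y : R) : x <= y -> exp x <= exp y.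
Proof. intros [H | ->]; [left; now apply exp_increasing | apply Rle_refl]. Qed.

Lemma exp_mult_nat (n : nat) (x : R) : exp x ^ n = exp (INR n * x).
Proof.
  induction n as [|n IH].
  - simpl. rewrite Rmult_0_l, exp_0; reflexivity.
  - rewrite <- tech_pow_Rmult, IH, <- exp_plus, S_INR. f_equal. ring.
Qed.

Lemma Csum_n_S (a : nat -> C) (n : nat) :
  sum_n (G := C_AbelianMonoid) a (S n) = (sum_n (G := C_AbelianMonoid) a n + a (S n))%C.
Proof. apply (sum_Sn (G := C_AbelianMonoid)). Qed.

(** The right-hand side is [C0 (t^(m+1) + ... + t^(m+p))] in closed form, which lets the induction
    on [p] close and stays bounded as [p] grows. *)
Lemma geometric_increment (a : nat -> C) (C0 t : R) (m p : nat) :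
  0 <= C0 -> 0 <= t < 1 -> (forall n, Cmod (a n) <= C0 * t ^ n) ->
  Cmod (sum_n (G := C_AbelianMonoid) a (m + p) - sum_n (G := C_AbelianMonoid) a m)
    <= C0 * t ^ S m * ((1 - t ^ p) / (1 - t)).
Proof.
  intros HC Ht Ha. induction p as [|p IH].
  - rewrite Nat.add_0_r. unfold Cminus. rewrite Cplus_opp_r, Cmod_0. simpl.
    replace ((1 - 1) / (1 - t)) with 0 by (field; lra). lra.
  - rewrite Nat.add_succ_r, Csum_n_S.
    replace (sum_n (G := C_AbelianMonoid) a (m + p) + a (S (m + p)) -
             sum_n (G := C_AbelianMonoid) a m)%C
      with ((sum_n (G := C_AbelianMonoid) a (m + p) -
             sum_n (G := C_AbelianMonoid) a m) + a (S (m + p)))%C by ring.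
    eapply Rle_trans; [apply Cmod_triangle|].
    eapply Rle_trans; [apply Rplus_le_compat; [exact IH | apply Ha]|].
    apply Req_le. replace (S (m + p)) with (S m + p)%nat by lia. rewrite pow_add. simpl. field.
    lra.
Qed.

Lemma geometric_tail (a : nat -> C) (l : C) (C0 t : R) (m : nat) :
  is_series (K := C_AbsRing) (V := C_NormedModule) a l ->
  0 <= C0 -> 0 <= t < 1 -> (forall n, Cmod (a n) <= C0 * t ^ n) ->
  Cmod (l - sum_n (G := C_AbelianMonoid) a m) <= C0 * t ^ S m / (1 - t).
Proof.
  intros Hs HC Ht Ha. apply le_epsilon. intros eps Heps.
  assert (H := proj1 (filterlim_locally_ball_norm (K := C_AbsRing) (U := C_NormedModule)
     (F := eventually) _ _) Hs (mkposreal eps Heps)).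
  destruct H as [N HN].
  assert (H1 := HN (m + N)%nat ltac:(lia)). unfold ball_norm in H1. simpl in H1.
  change (Cmod (sum_n (G := C_AbelianMonoid) a (m + N) - l) < eps) in H1.
  assert (H2 := geometric_increment a C0 t m N HC Ht Ha).
  replace (l - sum_n (G := C_AbelianMonoid) a m)%C with
    (- (sum_n (G := C_AbelianMonoid) a (m + N) - l) +
     (sum_n (G := C_AbelianMonoid) a (m + N) - sum_n (G := C_AbelianMonoid) a m))%C by ring.
  eapply Rle_trans; [apply Cmod_triangle|]. rewrite Cmod_opp.
  assert (C0 * t ^ S m * ((1 - t ^ N) / (1 - t)) <= C0 * t ^ S m / (1 - t)).
  { unfold Rdiv at 1. rewrite <- Rmult_assoc. apply Rmult_le_compat_r.
    - left; apply Rinv_0_lt_compat; lra.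
    - assert (0 <= t ^ S m) by (apply pow_le; lra).
      assert (0 <= t ^ N) by (apply pow_le; lra).
      assert (0 <= C0 * t ^ S m) by (apply Rmult_le_pos; assumption). nra. }
  lra.
Qed.

Lemma series_terms_bounded (a : nat -> C) (l : C) :
  is_series (K := C_AbsRing) (V := C_NormedModule) a l ->
  exists M, forall n, Cmod (a n) <= M.
Proof.
  intros Hs.
  destruct (@filterlim_bounded C_AbsRing C_NormedModule
              (sum_n (G := C_AbelianMonoid) a)) as [M HM]; [now exists l|].
  assert (HM' : forall n, Cmod (sum_n (G := C_AbelianMonoid) a n) <= M) by exact HM.
  exists (M + M). intros [|n].
  - assert (H := HM' 0%nat). rewrite sum_O in H.
    assert (H0 := Cmod_ge_0 (a 0%nat)). lra.
  - replace (a (S n)) with (sum_n (G := C_AbelianMonoid) a (S n)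
                            + - sum_n (G := C_AbelianMonoid) a n)%C
      by (rewrite Csum_n_S; ring).
    eapply Rle_trans; [apply Cmod_triangle|]. rewrite Cmod_opp.
    apply Rplus_le_compat; apply HM'.
Qed.

(** Abel's argument: convergence at height [y0 / 2] bounds the terms there, and each index gains a
    factor [exp (- 2 pi (Im z - y0 / 2) / h)] on moving up to [z]. On [Im z >= y0] this factor stays
    below a constant [rho < 1], so [B] depends neither on [m] nor on [z]. *)
Lemma fourier_tail (h : nat) (f : C -> C) (a : nat -> C) (y0 : R) :
  (1 <= h)%nat -> 0 < y0 -> fourier_expansion h f a ->
  exists B, 0 <= B /\ forall (m : nat) (z : C), y0 <= Im z ->
    Cmod (f z - sum_n (G := C_AbelianMonoid) (fun n => a n * qexp h z ^ n)%C m)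
      <= B * exp (- (2 * PI * (Im z - y0 / 2) / INR h)) ^ S m.
Proof.
  intros Hh Hy Hf.
  assert (Hh0 : 0 < INR h) by (apply lt_0_INR; lia).
  assert (HPI := PI_RGT_0).
  set (z0 := (0, y0 / 2) : C).
  assert (Hb : exists M, forall n, Cmod (a n * qexp h z0 ^ n) <= M).
  { apply (series_terms_bounded _ (f z0)).
    eapply is_series_ext; [|apply Hf; simpl; lra].
    intros n. simpl. now rewrite <- fourier_char. }
  destruct Hb as [M HM].
  assert (HM0 : 0 <= M) by (eapply Rle_trans; [apply Cmod_ge_0 | apply (HM 0%nat)]).
  set (rho := exp (- (2 * PI * (y0 / 2) / INR h))).
  assert (Hrho : 0 < rho < 1).
  { split; [apply exp_pos|]. unfold rho. rewrite <- exp_0. apply exp_increasing.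
    assert (0 < 2 * PI * (y0 / 2) / INR h); [|lra].
    apply Rdiv_lt_0_compat; [|exact Hh0]. apply Rmult_lt_0_compat; lra. }
  exists (M / (1 - rho)). split.
  { apply Rmult_le_pos; [exact HM0|]. left; apply Rinv_0_lt_compat; lra. }
  intros m z Hz.
  set (t := exp (- (2 * PI * (Im z - y0 / 2) / INR h))).
  assert (Ht : 0 < t <= rho).
  { split; [apply exp_pos|]. unfold t, rho. apply exp_monotone.
    assert (2 * PI * (y0 / 2) / INR h <= 2 * PI * (Im z - y0 / 2) / INR h); [|lra].
    apply Rmult_le_compat_r; [left; now apply Rinv_0_lt_compat|]. nra. }
  assert (Htail : Cmod (f z - sum_n (G := C_AbelianMonoid) (fun n => a n * qexp h z ^ n)%C m)
            <= M * t ^ S m / (1 - t)).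
  { apply geometric_tail; [|exact HM0|lra|].
    - eapply is_series_ext; [|apply Hf; lra].
      intros n. simpl. now rewrite <- fourier_char.
    - intros n. rewrite Cmod_mult, Cmod_pow, Cmod_qexp by exact Hh.
      assert (H := HM n). rewrite Cmod_mult, Cmod_pow, Cmod_qexp in H by exact Hh.
      replace (exp (- (2 * PI * Im z / INR h))) with (exp (- (2 * PI * Im z0 / INR h)) * t).
      + rewrite Rpow_mult_distr, <- Rmult_assoc.
        apply Rmult_le_compat_r; [apply pow_le; lra|exact H].
      + unfold t. rewrite <- exp_plus. f_equal. simpl. field. lra. }
  eapply Rle_trans; [exact Htail|].
  unfold Rdiv. rewrite Rmult_assoc, (Rmult_comm (t ^ S m)), <- Rmult_assoc.
  apply Rmult_le_compat_r; [apply pow_le; lra|]. apply Rmult_le_compat_l; [exact HM0|].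
  apply Rinv_le_contravar; lra.
Qed.

(** * Boundedness of cusp forms *)

Lemma SL2Z_mul (g h : mat2) : SL2Z g -> SL2Z h -> SL2Z (mat2_mul g h).
Proof.
  destruct g as [a b c d], h as [a' b' c' d']; unfold SL2Z; simpl. intros H1 H2.
  replace ((a * a' + b * c') * (c * b' + d * d') - (a * b' + b * d') * (c * a' + d * c'))%Z
    with ((a * d - b * c) * (a' * d' - b' * c'))%Z by ring.
  rewrite H1, H2. reflexivity.
Qed.

Definition mat2_inv (g : mat2) : mat2 := Mat2 (md g) (- mb g) (- mc g) (ma g).

Lemma SL2Z_inv (g : mat2) : SL2Z g -> SL2Z (mat2_inv g).
Proof. destruct g as [a b c d]; unfold SL2Z; simpl. lia. Qed.

Lemma automorphy_coord (g : mat2) (x y : R) :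
  automorphy g (x, y) = (IZR (mc g) * x + IZR (md g), IZR (mc g) * y).
Proof. unfold automorphy, IZC, RtoC, Cplus, Cmult; simpl. f_equal; ring. Qed.

Lemma SL2Z_IZR (g : mat2) :
  SL2Z g -> IZR (ma g) * IZR (md g) - IZR (mb g) * IZR (mc g) = 1.
Proof. unfold SL2Z. intros H. rewrite <- !mult_IZR, <- minus_IZR, H. reflexivity. Qed.

Lemma automorphy_neq_0 (g : mat2) (z : C) :
  SL2Z g -> 0 < Im z -> automorphy g z <> 0.
Proof.
  intros Hg Hz H. destruct z as [x y]. simpl in Hz. rewrite automorphy_coord in H.
  apply SL2Z_IZR in Hg. injection H as H1 H2.
  assert (Hc : IZR (mc g) = 0) by (apply Rmult_integral in H2; destruct H2; lra).
  rewrite Hc in *. assert (IZR (md g) = 0) by lra. nra.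
Qed.

Lemma Cmod_sqr_coord (x y : R) : Cmod (x, y) ^ 2 = x ^ 2 + y ^ 2.
Proof. apply (Cmod2_alt (x, y)). Qed.

Lemma moebius_Im (g : mat2) (z : C) :
  SL2Z g -> 0 < Im z -> Im (moebius g z) = Im z / Cmod (automorphy g z) ^ 2.
Proof.
  intros Hg Hz. assert (Hn := automorphy_neq_0 g z Hg Hz).
  assert (Hp : 0 < Cmod (automorphy g z) ^ 2).
  { apply pow_lt. now apply Cmod_gt_0. }
  destruct z as [x y]. unfold moebius.
  rewrite automorphy_coord in *. rewrite Cmod_sqr_coord in *.
  unfold IZC, RtoC, Cdiv, Cinv, Cmult, Cplus; simpl in *.
  apply SL2Z_IZR in Hg.
  field_simplify; [|nra|nra]. f_equal.
  transitivity (y * (IZR (ma g) * IZR (md g) - IZR (mb g) * IZR (mc g))); [ring|rewrite Hg; ring].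
Qed.

Lemma moebius_Im_pos (g : mat2) (z : C) : SL2Z g -> 0 < Im z -> 0 < Im (moebius g z).
Proof.
  intros Hg Hz. rewrite moebius_Im by assumption. apply Rdiv_lt_0_compat; [exact Hz|].
  apply pow_lt, Cmod_gt_0. now apply automorphy_neq_0.
Qed.

Lemma IZC_plus (m n : Z) : IZC (m + n) = (IZC m + IZC n)%C.
Proof. unfold IZC. now rewrite plus_IZR, RtoC_plus. Qed.

Lemma IZC_mult (m n : Z) : IZC (m * n) = (IZC m * IZC n)%C.
Proof. unfold IZC. now rewrite mult_IZR, RtoC_mult. Qed.

Lemma automorphy_mul (g h : mat2) (z : C) :
  SL2Z h -> 0 < Im z ->
  automorphy (mat2_mul g h) z = (automorphy g (moebius h z) * automorphy h z)%C.
Proof.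
  intros Hh Hz. assert (Hn := automorphy_neq_0 h z Hh Hz).
  unfold moebius. unfold automorphy at 1 2. simpl. rewrite !IZC_plus, !IZC_mult.
  transitivity (IZC (mc g) * (IZC (ma h) * z + IZC (mb h)) +
                IZC (md g) * automorphy h z)%C; [unfold automorphy; ring|].
  field. exact Hn.
Qed.

Lemma moebius_mul (g h : mat2) (z : C) :
  SL2Z g -> SL2Z h -> 0 < Im z ->
  moebius (mat2_mul g h) z = moebius g (moebius h z).
Proof.
  intros Hg Hh Hz. assert (Hn := automorphy_neq_0 h z Hh Hz).
  assert (Hn' := automorphy_neq_0 g _ Hg (moebius_Im_pos h z Hh Hz)).
  unfold moebius at 1 2. rewrite automorphy_mul by assumption.
  assert (E : (IZC (ma (mat2_mul g h)) * z + IZC (mb (mat2_mul g h)) =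
           (IZC (ma g) * moebius h z + IZC (mb g)) * automorphy h z)%C).
  { simpl. rewrite !IZC_plus, !IZC_mult.
    transitivity (IZC (ma g) * (IZC (ma h) * z + IZC (mb h)) +
                  IZC (mb g) * automorphy h z)%C; [unfold automorphy; ring|].
    unfold moebius. field. exact Hn. }
  rewrite E. field. split; assumption.
Qed.

Lemma slash_mul (k : nat) (f : C -> C) (g h : mat2) (z : C) :
  SL2Z g -> SL2Z h -> 0 < Im z ->
  slash k f (mat2_mul g h) z = slash k (slash k f g) h z.
Proof.
  intros Hg Hh Hz. assert (Hn := automorphy_neq_0 h z Hh Hz).
  assert (Hn' := automorphy_neq_0 g _ Hg (moebius_Im_pos h z Hh Hz)).
  unfold slash. rewrite moebius_mul, automorphy_mul, Cpow_mult_l by assumption.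
  field. split; now apply Cpow_nz.
Qed.

Lemma mat2_mul_inv_cancel (g h : mat2) :
  SL2Z h -> mat2_mul (mat2_mul g (mat2_inv h)) h = g.
Proof.
  destruct g as [a b c d], h as [a' b' c' d']; unfold SL2Z, mat2_mul; simpl. intros H.
  assert (E : forall u v : Z, ((u * d' + v * - c') * a' + (u * - b' + v * a') * c' = u)%Z /\
                              ((u * d' + v * - c') * b' + (u * - b' + v * a') * d' = v)%Z).
  { intros u v; split.
    - transitivity (u * (a' * d' - b' * c'))%Z; [ring|rewrite H; ring].
    - transitivity (v * (a' * d' - b' * c'))%Z; [ring|rewrite H; ring]. }
  f_equal; apply E.
Qed.

Definition mat2_one : mat2 := Mat2 1 0 0 1.

Lemma SL2Z_one : SL2Z mat2_one.
Proof. reflexivity. Qed.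

Lemma moebius_one (z : C) : moebius mat2_one z = z.
Proof. unfold moebius, automorphy, IZC; simpl. field. Qed.

Lemma mat2_inv_mul (g : mat2) : SL2Z g -> mat2_mul (mat2_inv g) g = mat2_one.
Proof.
  destruct g as [a b c d]; unfold SL2Z, mat2_mul, mat2_one; simpl. intros H.
  f_equal; lia.
Qed.

Lemma moebius_inv (g : mat2) (z : C) :
  SL2Z g -> 0 < Im z -> moebius (mat2_inv g) (moebius g z) = z.
Proof.
  intros Hg Hz. rewrite <- moebius_mul by (try apply SL2Z_inv; assumption).
  rewrite mat2_inv_mul by exact Hg. apply moebius_one.
Qed.

(* When [Im z < 1/2], translating [z] into [|Re z| <= 1/2] and inverting
   at least doubles the imaginary part. *)
Lemma reduction (z : C) :
  0 < Im z -> exists g, SL2Z g /\ 1 / 2 <= Im (moebius g z).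
Proof.
  (* Induction on the number [n] of doublings that suffice to reach height [1 / 2]. *)
  assert (Hind : forall n z, 0 < Im z -> 1 / 2 <= 2 ^ n * Im z ->
            exists g, SL2Z g /\ 1 / 2 <= Im (moebius g z)).
  { clear z. induction n as [|n IH]; intros z Hz Hn.
    - exists mat2_one. split; [exact SL2Z_one|]. rewrite moebius_one. simpl in Hn. lra.
    - destruct (Rle_dec (1 / 2) (Im z)) as [H|H].
      { exists mat2_one. split; [exact SL2Z_one|]. now rewrite moebius_one. }
      destruct z as [x y]; simpl in Hz, Hn, H.
      (* [m = up (x - 1/2)] satisfies [|x - m| <= 1/2]. With [y < 1/2] this gives
         [|z - m|^2 <= 1/2], whence the doubling. *)
      destruct (archimed (x - 1 / 2)) as [H1 H2].
      set (m := up (x - 1 / 2)) in *.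
      set (g1 := Mat2 0 (-1) 1 (- m)).
      assert (Hg1 : SL2Z g1) by (unfold SL2Z; simpl; lia).
      assert (HI : 2 * y <= Im (moebius g1 (x, y))).
      { rewrite moebius_Im by (simpl; assumption).
        assert (Hp : 0 < Cmod (automorphy g1 (x, y)) ^ 2).
        { apply pow_lt, Cmod_gt_0. apply automorphy_neq_0; simpl; assumption. }
        rewrite automorphy_coord, Cmod_sqr_coord in *. simpl mc in *. simpl md in *.
        rewrite opp_IZR in *. simpl Im.
        apply (proj1 (Rle_div_r _ _ _ Hp)).
        assert ((1 * x + - IZR m) ^ 2 + (1 * y) ^ 2 <= 1 / 2) by nra. nra. }
      destruct (IH (moebius g1 (x, y))) as [g [Hg Hgi]].
      { now apply moebius_Im_pos. }
      { assert (0 < 2 ^ n) by (apply pow_lt; lra). nra. }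
      exists (mat2_mul g g1). split; [now apply SL2Z_mul|].
      rewrite moebius_mul; assumption. }
  intros Hz. destruct (Pow_x_infinity 2 ltac:(rewrite Rabs_right; lra) (/ (2 * Im z))) as [n Hn].
  apply (Hind n z Hz). assert (H := Hn n (le_n n)).
  rewrite Rabs_right in H by (apply Rle_ge, pow_le; lra).
  apply Rge_le in H. apply (Rmult_le_compat_r (Im z)) in H; [|lra].
  replace (/ (2 * Im z) * Im z) with (1 / 2) in H by (field; lra). exact H.
Qed.

(** Raise [b y <= exp (b y)] to the power [n]; taking [b = alpha / (n + 1)] rather than [alpha / n]
    also covers [n = 0]. *)
Lemma pow_le_exp (n : nat) (alpha : R) :
  0 < alpha -> exists D, 0 <= D /\ forall y, 0 <= y -> y ^ n <= D * exp (alpha * y).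
Proof.
  intros Ha. set (b := alpha / INR (S n)).
  assert (Hn : 0 < INR (S n)) by (apply lt_0_INR; lia).
  assert (Hb : 0 < b) by now apply Rdiv_lt_0_compat.
  exists ((/ b) ^ n). split; [apply pow_le; left; now apply Rinv_0_lt_compat|].
  intros y Hy.
  apply Rle_trans with ((/ b * exp (b * y)) ^ n).
  - apply pow_incr. split; [exact Hy|].
    apply Rmult_le_reg_l with b; [exact Hb|]. rewrite <- Rmult_assoc, Rinv_r, Rmult_1_l by lra.
    assert (H := exp_ineq1_le (b * y)). lra.
  - rewrite Rpow_mult_distr. apply Rmult_le_compat_l; [apply pow_le; left;
      now apply Rinv_0_lt_compat|].
    rewrite exp_mult_nat. apply exp_monotone. rewrite <- Rmult_assoc.
    apply Rmult_le_compat_r; [exact Hy|]. unfold b.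
    apply Rmult_le_reg_r with (INR (S n)); [exact Hn|].
    replace (INR n * (alpha / INR (S n)) * INR (S n)) with (alpha * INR n) by (field; lra).
    apply Rmult_le_compat_l; [lra|]. apply le_INR; lia.
Qed.

(** Each hypothesis holds for all large bounds, so the maximum of finitely many thresholds serves.
    It is applied twice, to the two entries of a bottom row modulo [N]. *)
Lemma uniform_bound_below (n : nat) (Q : nat -> R -> Prop) :
  (forall i, (i < n)%nat -> exists B, forall B', B <= B' -> Q i B') ->
  exists B, forall B', B <= B' -> forall i, (i < n)%nat -> Q i B'.
Proof.
  induction n as [|n IH]; intros H.
  - exists 0. intros; lia.
  - destruct IH as [B1 H1]; [intros i Hi; apply H; lia|].
    destruct (H n) as [B2 H2]; [lia|].
    exists (Rmax B1 B2). intros B' HB' i Hi.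
    assert (B1 <= B') by (eapply Rle_trans; [apply Rmax_l|exact HB']).
    assert (B2 <= B') by (eapply Rle_trans; [apply Rmax_r|exact HB']).
    destruct (Nat.eq_dec i n) as [->|Hin]; [now apply H2|apply H1; [assumption|lia]].
Qed.

(** From [Im (g z) = Im z / |c z + d|^2]. Bounds for all slashes of [f] high in the half-plane
    thereby become bounds for [|f| y^l] everywhere. *)
Lemma Cmod_slash (l : nat) (f : C -> C) (g : mat2) (z : C) :
  SL2Z g -> 0 < Im z ->
  Cmod (f (moebius g z)) * Im (moebius g z) ^ l = Cmod (slash (2 * l) f g z) * Im z ^ l.
Proof.
  intros Hg Hz. assert (Hn := automorphy_neq_0 g z Hg Hz).
  assert (Hp := proj1 (Cmod_gt_0 _) Hn).
  unfold slash. rewrite Cmod_div by now apply Cpow_nz.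
  rewrite moebius_Im, Cmod_pow by assumption.
  unfold Rdiv. rewrite Rpow_mult_distr, pow_inv, <- pow_mult. field.
  apply pow_nonzero; lra.
Qed.

Section CuspFormBound.
Context (N l : nat) (f : C -> C) (HN : (1 <= N)%nat) (Hf : cusp_form N (2 * l) f).

(** As the constant term vanishes, the slash decays like [exp (- 2 pi y / N)], which beats [y^l].
    The bound may still depend on [g]. *)
Lemma slash_bounded (g : mat2) :
  SL2Z g -> exists B, forall z, 1 / 2 <= Im z ->
    Cmod (slash (2 * l) f g z) * Im z ^ l <= B.
Proof.
  intros Hg. destruct Hf as [_ [_ Hc]]. destruct (Hc g Hg) as [a [Ha0 Ha]].
  destruct (fourier_tail N _ a (1 / 2) HN ltac:(lra) Ha) as [B [HB HBt]].
  assert (HN0 : 0 < INR N) by (apply lt_0_INR; lia).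
  assert (HPI := PI_RGT_0).
  set (al := 2 * PI / INR N).
  assert (Hal : 0 < al) by (apply Rdiv_lt_0_compat; lra).
  destruct (pow_le_exp l al Hal) as [D [HD HDl]].
  exists (B * D * exp (al / 4)). intros z Hz.
  assert (H := HBt 0%nat z Hz). rewrite sum_O, Ha0 in H.
  replace (slash (2 * l) f g z - 0 * qexp N z ^ 0)%C with (slash (2 * l) f g z) in H by ring.
  rewrite pow_1 in H.
  apply Rle_trans with (B * exp (- (2 * PI * (Im z - 1 / 2 / 2) / INR N)) * (D * exp (al * Im
      z))).
  - apply Rmult_le_compat; [apply Cmod_ge_0|apply pow_le; lra|exact H|apply HDl; lra].
  - apply Req_le.
    replace (exp (al / 4)) with (exp (- (2 * PI * (Im z - 1 / 2 / 2) / INR N)) * exp (al * Im z)).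
    + ring.
    + rewrite <- exp_plus. f_equal. unfold al. field. lra.
Qed.

(** The lower left entry of [g h^(-1)] is [mc g * md h - md g * mc h], divisible by [N] when the
    bottom rows agree modulo [N]. So [f] has at most [N^2] distinct slashes, which does the work of
    the finite index of [Gamma0 N]. *)
Lemma slash_depends_on_bottom_row (g h : mat2) (z : C) :
  SL2Z g -> SL2Z h -> 0 < Im z ->
  (mc g mod Z.of_nat N = mc h mod Z.of_nat N)%Z ->
  (md g mod Z.of_nat N = md h mod Z.of_nat N)%Z ->
  slash (2 * l) f g z = slash (2 * l) f h z.
Proof.
  intros Hg Hh Hz Hc Hd.
  rewrite <- (mat2_mul_inv_cancel g h Hh).
  assert (Hgh : SL2Z (mat2_mul g (mat2_inv h))) by (apply SL2Z_mul; [|apply SL2Z_inv];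
    assumption).
  rewrite slash_mul by assumption.
  unfold slash at 1. destruct Hf as [_ [Hinv _]].
  rewrite Hinv; [reflexivity| |now apply moebius_Im_pos].
  split; [exact Hgh|].
  apply Z.mod_divide; [lia|]. simpl.
  rewrite <- Z.add_mod_idemp_l, <- Z.add_mod_idemp_r by lia.
  rewrite <- (Z.mul_mod_idemp_l (mc g)), <- (Z.mul_mod_idemp_l (md g)) by lia.
  rewrite Hc, Hd. rewrite !Z.mul_mod_idemp_l, Z.add_mod_idemp_l, Z.add_mod_idemp_r by lia.
  replace (mc h * md h + md h * - mc h)%Z with 0%Z by ring. apply Z.mod_0_l. lia.
Qed.

Lemma slash_uniformly_bounded :
  exists B, forall g z, SL2Z g -> 1 / 2 <= Im z ->
    Cmod (slash (2 * l) f g z) * Im z ^ l <= B.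
Proof.
  set (Q := fun (i j : nat) (B : R) => forall g z, SL2Z g -> 1 / 2 <= Im z ->
    (mc g mod Z.of_nat N = Z.of_nat i)%Z -> (md g mod Z.of_nat N = Z.of_nat j)%Z ->
    Cmod (slash (2 * l) f g z) * Im z ^ l <= B).
  destruct (uniform_bound_below N (fun i B => forall j, (j < N)%nat -> Q i j B)) as [B HB].
  - intros i Hi. apply uniform_bound_below. intros j Hj.
    (* Bound the slash by one representative of the residue pair; if there is none, any bound holds
       vacuously. *)
    destruct (classic (exists g, SL2Z g /\ (mc g mod Z.of_nat N = Z.of_nat i)%Z /\
                                 (md g mod Z.of_nat N = Z.of_nat j)%Z)) as [[h [Hh [Hhc
                                     Hhd]]]|Hno].
    + destruct (slash_bounded h Hh) as [B HB]. exists B. intros B' HB' g z Hg Hz Hc Hd.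
      rewrite (slash_depends_on_bottom_row g h z) by (congruence || lra || assumption).
      eapply Rle_trans; [now apply HB|exact HB'].
    + exists 0. intros B' _ g z Hg Hz Hc Hd. exfalso; apply Hno. now exists g.
  - exists B. intros g z Hg Hz.
    assert (H1 := Z.mod_pos_bound (mc g) (Z.of_nat N) ltac:(lia)).
    assert (H2 := Z.mod_pos_bound (md g) (Z.of_nat N) ltac:(lia)).
    apply (HB B (Rle_refl B) (Z.to_nat (mc g mod Z.of_nat N)) ltac:(lia)
              (Z.to_nat (md g mod Z.of_nat N)) ltac:(lia) g z Hg Hz); lia.
Qed.

(** Move [z] to [g z] of height at least [1/2]; then [|f z| y^l] is the corresponding quantity for
    the slash by [g^(-1)] at [g z]. *)
Lemma cusp_form_bounded :
  exists B, forall z, 0 < Im z -> Cmod (f z) * Im z ^ l <= B.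
Proof.
  destruct slash_uniformly_bounded as [B HB]. exists B. intros z Hz.
  destruct (reduction z Hz) as [g [Hg Hgz]].
  rewrite <- (moebius_inv g z Hg Hz) at 1 2.
  rewrite Cmod_slash by (try apply SL2Z_inv; try apply moebius_Im_pos; assumption).
  apply HB; [now apply SL2Z_inv|exact Hgz].
Qed.

End CuspFormBound.

(** * Hecke eigenvalues *)

(* Coquelicot's sums have type [AbelianMonoid.sort C_AbelianMonoid], which [ring]
   does not identify with [C]. *)
Ltac Cring := first [ring | match goal with |- @eq _ ?x ?y => change (@eq C x y) end; ring].

Ltac Cfield := match goal with |- @eq _ ?x ?y => change (@eq C x y) end; field.

Lemma Cmod_sum_n_m (u : nat -> C) (n m : nat) :
  Cmod (sum_n_m (G := C_AbelianMonoid) u n m) <= sum_n_m (fun i => Cmod (u i)) n m.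
Proof. exact (norm_sum_n_m (K := C_AbsRing) (V := C_NormedModule) u n m). Qed.

Lemma Cmult_sum_n (c : C) (u : nat -> C) (n : nat) :
  (c * sum_n (G := C_AbelianMonoid) u n)%C =
  sum_n (G := C_AbelianMonoid) (fun i => c * u i)%C n.
Proof. symmetry. exact (sum_n_mult_l (K := C_Ring) c u n). Qed.

Lemma Cminus_sum_n (u v : nat -> C) (n : nat) :
  (sum_n (G := C_AbelianMonoid) u n - sum_n (G := C_AbelianMonoid) v n)%C =
  sum_n (G := C_AbelianMonoid) (fun i => u i - v i)%C n.
Proof.
  induction n as [|n IH]; [rewrite !sum_O; reflexivity|].
  rewrite !Csum_n_S, <- IH. ring.
Qed.

Lemma sum_n_only_last (u : nat -> C) (d : nat) :
  (forall n, (n < d)%nat -> u n = 0) -> sum_n (G := C_AbelianMonoid) u d = u d.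
Proof.
  intros Hu. destruct d as [|d]; [apply sum_O|]. rewrite Csum_n_S.
  replace (sum_n (G := C_AbelianMonoid) u d) with (RtoC 0).
  - Cring.
  - symmetry. assert (H : forall e, (e <= d)%nat -> sum_n (G := C_AbelianMonoid) u e = RtoC 0).
    { induction e as [|e IH]; intros He.
      - rewrite sum_O. apply Hu. lia.
      - rewrite Csum_n_S, IH, Hu by lia. Cring. }
    apply H. lia.
Qed.

Lemma sum_n_Cconst (c : C) (n : nat) :
  sum_n (G := C_AbelianMonoid) (fun _ => c) n = (INC (S n) * c)%C.
Proof.
  induction n as [|n IH].
  - rewrite sum_O. unfold INC; simpl INR. Cring.
  - rewrite Csum_n_S, IH. unfold INC. rewrite (S_INR (S n)), RtoC_plus. Cring.
Qed.

Lemma qexp_plus (h : nat) (z w : C) : qexp h (z + w) = (qexp h z * qexp h w)%C.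
Proof. unfold qexp. rewrite <- Cexp_plus. f_equal. unfold Cdiv. Cring. Qed.

Lemma qexp_mult_nat (h n : nat) (z : C) : qexp h (INC n * z) = (qexp h z ^ n)%C.
Proof. unfold qexp. rewrite <- Cexp_nat_mult. f_equal. unfold Cdiv. Cring. Qed.

Lemma qexp_1_div (d : nat) (z : C) : qexp 1 (z / INC d) = qexp d z.
Proof.
  unfold qexp. f_equal. unfold Cdiv. rewrite (INC_inv 1) by lia. simpl INR.
  rewrite Rinv_1. Cring.
Qed.

Lemma qexp_self (d : nat) : (1 <= d)%nat -> qexp d (INC d) = 1.
Proof.
  intros Hd. unfold qexp.
  replace (2 * PI * Ci * INC d / INC d)%C with (0, 2 * PI) by
    (transitivity (2 * PI * Ci)%C;
     [unfold Ci, RtoC, Cmult; simpl; f_equal; Cring | Cfield; now apply INC_neq_0]).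
  unfold Cexp; simpl. rewrite exp_0, cos_2PI, sin_2PI. unfold RtoC. f_equal; Cring.
Qed.

Lemma qexp_neq_1 (d m : nat) : (0 < m < d)%nat -> qexp d (INC m) <> 1.
Proof.
  intros Hm H. unfold qexp in H.
  assert (Hd : 0 < INR d) by (apply lt_0_INR; lia).
  assert (Hm0 : 0 < INR m) by (apply lt_0_INR; lia).
  assert (Hmd : INR m < INR d) by (apply lt_INR; lia).
  (* The real part of the root of unity is [cos (2 th) = 1 - 2 sin^2 th], and [sin th > 0] because
     [0 < th < pi]. *)
  set (th := PI * (INR m / INR d)).
  replace (2 * PI * Ci * INC m / INC d)%C with (0, 2 * th) in H.
  2: { unfold Cdiv. rewrite INC_inv by lia. unfold th, INC, Ci, RtoC, Cmult; simpl.
       f_equal; field; lra. }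
  unfold Cexp in H. simpl in H. injection H as H1 _.
  rewrite exp_0, Rmult_1_l, cos_2a_sin in H1.
  assert (Hr : 0 < INR m / INR d < 1).
  { split; [now apply Rdiv_lt_0_compat|]. apply Rlt_div_l; lra. }
  assert (HPI := PI_RGT_0).
  assert (Hs : 0 < sin th) by (apply sin_gt_0; unfold th; nra).
  nra.
Qed.

Lemma geometric_sum_root (z : C) (n : nat) :
  z <> 1 -> (z ^ S n)%C = 1 ->
  sum_n (G := C_AbelianMonoid) (fun b => z ^ b)%C n = RtoC 0.
Proof.
  intros Hz Hn.
  assert (H : forall m, ((z - 1) * sum_n (G := C_AbelianMonoid) (fun b => z ^ b)%C m = z ^ S m -
      1)%C).
  { induction m as [|m IH].
    - rewrite sum_O. simpl. Cring.
    - rewrite Csum_n_S, Cmult_plus_distr_l, IH, !Cpow_S. Cring. }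
  assert (H1 := H n). rewrite Hn in H1.
  assert (Hz1 : (z - 1)%C <> 0) by (intros E; apply Hz; replace z with (z - 1 + 1)%C by Cring;
    rewrite E; Cring).
  apply (f_equal (Cmult (/ (z - 1)))) in H1. rewrite Cmult_assoc, Cinv_l in H1 by exact Hz1.
  rewrite Cmult_1_l in H1. rewrite H1. Cring.
Qed.

(** Orthogonality of the [d]-th roots of unity: averaging over [b] kills the indices [0 < n < d],
    and [a 0 = 0]. The index [n = d] contributes [d a_d q^d], and the tail [n > d] is of the order
    of [q^(d+1)]. *)
Lemma average_translates (f : C -> C) (a : nat -> C) (d : nat) :
  (1 <= d)%nat -> fourier_expansion 1 f a -> a 0%nat = 0 ->
  exists B, forall w, 1 <= Im w ->
    Cmod (sum_n (G := C_AbelianMonoid) (fun b => f (w + INC b / INC d)%C) (d - 1)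
          - INC d * a d * qexp 1 w ^ d)
      <= B * exp (- (2 * PI * (INR d + 1) * Im w)).
Proof.
  intros Hd Hf Ha0.
  destruct (fourier_tail 1 f a 1 ltac:(lia) ltac:(lra) Hf) as [B [HB HBt]].
  (* The tail bound at [y0 = 1] is [exp (- 2 pi (Im w - 1/2))^(d+1)] for each of the [d] translates;
     the shift by [1/2] costs [exp (pi (d + 1))]. *)
  exists (INR d * B * exp (PI * (INR d + 1))). intros w Hw.
  set (main := fun b => sum_n (G := C_AbelianMonoid)
                (fun n => a n * qexp 1 (w + INC b / INC d) ^ n)%C d).
  assert (Hmain : sum_n (G := C_AbelianMonoid) main (d - 1) = (INC d * a d * qexp 1 w ^ d)%C).
  { unfold main. rewrite sum_n_switch. rewrite sum_n_only_last.
    - rewrite (sum_n_ext _ (fun _ => a d * qexp 1 w ^ d)%C).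
      + rewrite sum_n_Cconst. replace (S (d - 1)) with d by lia. Cring.
      + intros b. rewrite qexp_plus, qexp_1_div, Cpow_mult_l.
        replace (INC b) with (INC b * 1)%C by Cring.
        rewrite <- (qexp_mult_nat d d). rewrite Cmult_1_r.
        replace (INC d * INC b)%C with (INC b * INC d)%C by Cring.
        rewrite qexp_mult_nat, qexp_self, Cpow_1_l by exact Hd. Cring.
    - intros n Hn.
      rewrite (sum_n_ext _ (fun b => (a n * qexp 1 w ^ n) * qexp d (INC n) ^ b)%C).
      + rewrite <- Cmult_sum_n. destruct n as [|n]; [rewrite Ha0; Cring|].
        rewrite geometric_sum_root; [Cring| |].
        * apply qexp_neq_1. lia.
        * replace (S (d - 1)) with d by lia. rewrite <- qexp_mult_nat.
          replace (INC d * INC (S n))%C with (INC (S n) * INC d)%C by Cring.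
          rewrite qexp_mult_nat, qexp_self, Cpow_1_l by exact Hd. reflexivity.
      + intros b. rewrite qexp_plus, qexp_1_div, Cpow_mult_l, <- !qexp_mult_nat.
        replace (INC b * INC n)%C with (INC n * INC b)%C by Cring. Cring. }
  rewrite <- Hmain, Cminus_sum_n.
  eapply Rle_trans; [apply Cmod_sum_n_m|].
  eapply Rle_trans.
  { apply (sum_n_m_le _ (fun _ => B * exp (PI * (INR d + 1)) * exp (- (2 * PI * (INR d + 1) * Im
        w)))).
    intros b. assert (Hi : Im (w + INC b / INC d)%C = Im w).
    { unfold Cdiv. rewrite INC_inv by exact Hd. destruct w; simpl. Cring. }
    assert (H := HBt d (w + INC b / INC d)%C). rewrite Hi in H.
    eapply Rle_trans; [apply H; exact Hw|]. rewrite exp_mult_nat, (Rmult_assoc B), <- exp_plus.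
    apply Req_le. f_equal. f_equal. rewrite S_INR. simpl. field. }
  rewrite sum_n_m_const. replace (S (d - 1) - 0)%nat with d by lia. apply Req_le. Cring.
Qed.

(* [o(e^(-2 pi y))] as [y -> +oo]. *)
Definition negligible (g : R -> C) : Prop :=
  forall eps, 0 < eps -> exists Y, forall y, Y <= y -> Cmod (g y) <= eps * exp (- (2 * PI * y)).

Lemma negligible_plus (g h : R -> C) :
  negligible g -> negligible h -> negligible (fun y => g y + h y)%C.
Proof.
  intros Hg Hh eps Heps.
  destruct (Hg (eps / 2) ltac:(lra)) as [Y1 H1].
  destruct (Hh (eps / 2) ltac:(lra)) as [Y2 H2].
  exists (Rmax Y1 Y2). intros y Hy.
  eapply Rle_trans; [apply Cmod_triangle|].
  assert (A := H1 y (Rle_trans _ _ _ (Rmax_l _ _) Hy)).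
  assert (A' := H2 y (Rle_trans _ _ _ (Rmax_r _ _) Hy)). lra.
Qed.

Lemma negligible_scal (c : C) (g : R -> C) :
  negligible g -> negligible (fun y => c * g y)%C.
Proof.
  intros Hg eps Heps. assert (Hc := Cmod_ge_0 c).
  destruct (Hg (eps / (Cmod c + 1))) as [Y H].
  { apply Rdiv_lt_0_compat; lra. }
  exists Y. intros y Hy. rewrite Cmod_mult.
  apply Rle_trans with ((Cmod c + 1) * (eps / (Cmod c + 1) * exp (- (2 * PI * y)))).
  - apply Rmult_le_compat; [exact Hc|apply Cmod_ge_0|lra|now apply H].
  - apply Req_le. field. lra.
Qed.

Lemma negligible_ext (g h : R -> C) (Y : R) :
  (forall y, Y <= y -> g y = h y) -> negligible g -> negligible h.
Proof.
  intros E Hg eps Heps. destruct (Hg eps Heps) as [Y1 H1].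
  exists (Rmax Y Y1). intros y Hy.
  rewrite <- E by (eapply Rle_trans; [apply Rmax_l|exact Hy]).
  apply H1. eapply Rle_trans; [apply Rmax_r|exact Hy].
Qed.

Lemma negligible_0 : negligible (fun _ => 0).
Proof.
  intros eps Heps. exists 0. intros y _. rewrite Cmod_0.
  apply Rmult_le_pos; [lra|left; apply exp_pos].
Qed.

Lemma negligible_sum_n_m (g : nat -> R -> C) (p m : nat) :
  (forall d, (p <= d <= m)%nat -> negligible (g d)) ->
  negligible (fun y => sum_n_m (G := C_AbelianMonoid) (fun d => g d y) p m).
Proof.
  induction m as [|m IH]; intros H.
  - destruct p as [|p].
    + apply (negligible_ext (g 0%nat) _ 0); [|now apply H].
      intros y _. now rewrite sum_n_n.
    + apply (negligible_ext (fun _ => RtoC 0) _ 0); [|exact negligible_0].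
      intros y _. now rewrite sum_n_m_zero by lia.
  - destruct (Nat.le_gt_cases p (S m)) as [Hp|Hp].
    + apply (negligible_ext (fun y => sum_n_m (G := C_AbelianMonoid) (fun d => g d y) p m + g (S
          m) y)%C _ 0).
      * intros y _. now rewrite sum_n_Sm by lia.
      * apply negligible_plus; [apply IH; intros d Hd; apply H; lia|apply H; lia].
    + apply (negligible_ext (fun _ => RtoC 0) _ 0); [|exact negligible_0].
      intros y _. now rewrite sum_n_m_zero by lia.
Qed.

Lemma negligible_exp (g : R -> C) (B c Y : R) :
  1 < c -> (forall y, Y <= y -> Cmod (g y) <= B * exp (- (2 * PI * c * y))) -> negligible g.
Proof.
  intros Hc Hg eps Heps. assert (HPI := PI_RGT_0).
  set (b := 2 * PI * (c - 1)). assert (Hb : 0 < b) by (unfold b; apply Rmult_lt_0_compat; lra).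
  set (B' := Rmax B 0). assert (HB' : 0 <= B') by apply Rmax_r.
  (* Beyond this point [exp (b y) >= b y >= B' / eps]. *)
  exists (Rmax Y (B' / eps / b)). intros y Hy.
  eapply Rle_trans; [apply Hg; eapply Rle_trans; [apply Rmax_l|exact Hy]|].
  apply (Rle_trans _ _ _ (Rmax_r _ _)) in Hy.
  replace (- (2 * PI * c * y)) with (- (b * y) + - (2 * PI * y)) by (unfold b; Cring).
  rewrite exp_plus, <- Rmult_assoc.
  apply Rmult_le_compat_r; [left; apply exp_pos|].
  assert (HBB : B <= B') by apply Rmax_l.
  apply Rle_trans with (B' * exp (- (b * y))).
  { apply Rmult_le_compat_r; [left; apply exp_pos|exact HBB]. }
  rewrite exp_Ropp.
  apply Rmult_le_reg_r with (exp (b * y)); [apply exp_pos|].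
  rewrite Rmult_assoc, Rinv_l, Rmult_1_r by apply Rgt_not_eq, exp_pos.
  assert (H1 := exp_ineq1_le (b * y)).
  apply Rle_trans with (eps * (b * y)); [|apply Rmult_le_compat_l; lra].
  apply (Rmult_le_compat_l (eps * b)) in Hy; [|left; now apply Rmult_lt_0_compat].
  replace (eps * b * (B' / eps / b)) with B' in Hy by (field; lra). lra.
Qed.

Definition sigma (n : nat) : R :=
  sum_n_m (fun d => if Nat.eqb (n mod d) 0 then INR d else 0) 1 n.

Lemma sigma_ge_0 (n : nat) : 0 <= sigma n.
Proof.
  unfold sigma. apply Rle_trans with (sum_n_m (fun _ => 0) 1 n).
  - rewrite sum_n_m_const. lra.
  - apply sum_n_m_le. intros d. destruct (Nat.eqb _ _); [apply pos_INR|lra].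
Qed.

Lemma Cmod_qexp_1 (z : C) : Cmod (qexp 1 z) = exp (- (2 * PI * Im z)).
Proof. rewrite Cmod_qexp by lia. simpl. f_equal. field. Qed.

Section HeckeBound.
Context (N l : nat) (f : C -> C) (a : nat -> C).
Context (HN : (1 <= N)%nat) (Hl : (1 <= l)%nat) (Hf : cusp_form N (2 * l) f).
Context (Ha : fourier_expansion 1 f a) (Ha1 : a 1%nat = 1).
Context (Heig : hecke_eigenform N (2 * l) f).

(** The cusp condition speaks of an expansion in [exp (2 pi i z / N)], not of [a]. Here [a 0 = 0]
    comes from growth: [f (iy) - a 0] decays exponentially and [|f (iy)| <= M y^(-l)] with [l >= 1],
    so [|a 0| y] stays bounded. *)
Lemma fourier_coeff_0 : a 0%nat = 0.
Proof.
  destruct (fourier_tail 1 f a 1 ltac:(lia) ltac:(lra) Ha) as [B [HB HBt]].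
  destruct (cusp_form_bounded N l f HN Hf) as [M HM].
  assert (HPI : 2 < PI) by (assert (H := PI2_1); lra).
  set (M' := Rmax M 0 + B).
  assert (HM' : 0 <= M') by (assert (H := Rmax_r M 0); unfold M'; lra).
  assert (Hy : forall y, 1 <= y -> Cmod (a 0%nat) * y <= M').
  { intros y Hy. assert (H1 := HBt 0%nat (0, y) Hy). rewrite sum_O, pow_1 in H1.
    simpl Cpow in H1. rewrite Cmult_1_r in H1. simpl Im in H1.
    assert (H2 := HM (0, y) ltac:(simpl; lra)). simpl Im in H2.
    assert (H3 : Cmod (a 0%nat) <= Cmod (f (0, y)) + Cmod (f (0, y) - a 0%nat)).
    { rewrite <- (Cmod_opp (f (0, y) - a 0%nat)).
      eapply Rle_trans; [|apply Cmod_triangle]. apply Req_le. f_equal. ring. }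
    assert (H4 : y <= y ^ l).
    { replace l with (S (l - 1)) by lia. simpl.
      assert (1 <= y ^ (l - 1)) by now apply pow_R1_Rle. nra. }
    assert (H5 : Cmod (f (0, y)) * y <= Rmax M 0).
    { eapply Rle_trans; [|eapply Rle_trans; [exact H2|apply Rmax_l]].
      apply Rmult_le_compat_l; [apply Cmod_ge_0|exact H4]. }
    assert (H6 : exp (- (2 * PI * (y - 1 / 2) / INR 1)) * y <= 1).
    { simpl INR. rewrite exp_Ropp.
      assert (Hx := exp_ineq1_le (2 * PI * (y - 1 / 2) / 1)).
      apply Rmult_le_reg_l with (exp (2 * PI * (y - 1 / 2) / 1)); [apply exp_pos|].
      rewrite <- Rmult_assoc, Rinv_r, Rmult_1_l, Rmult_1_r by apply Rgt_not_eq, exp_pos.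
      apply Rle_trans with (1 + 2 * PI * (y - 1 / 2) / 1); [|exact Hx]. nra. }
    assert (H7 : B * exp (- (2 * PI * (y - 1 / 2) / INR 1)) * y <= B).
    { rewrite Rmult_assoc. rewrite <- (Rmult_1_r B) at 2. now apply Rmult_le_compat_l. }
    unfold M'. nra. }
  apply Cmod_eq_0. assert (H0 := Cmod_ge_0 (a 0%nat)).
  destruct (Req_dec (Cmod (a 0%nat)) 0) as [E|E]; [exact E|exfalso].
  assert (Hp : 0 < Cmod (a 0%nat)) by lra.
  assert (H := Hy (1 + M' / Cmod (a 0%nat) + 1)).
  assert (0 <= M' / Cmod (a 0%nat)) by (apply Rmult_le_pos; [lra|left;
    now apply Rinv_0_lt_compat]).
  specialize (H ltac:(lra)).
  replace (Cmod (a 0%nat) * (1 + M' / Cmod (a 0%nat) + 1)) with (2 * Cmod (a 0%nat) + M') in H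
    by (field; lra). lra.
Qed.

Lemma form_leading_term : negligible (fun y => f (0%R, y) - qexp 1 (0%R, y))%C.
Proof.
  destruct (average_translates f a 1 ltac:(lia) Ha fourier_coeff_0) as [B HB].
  apply (negligible_exp _ B 2 1); [lra|]. intros y Hy.
  assert (H := HB (0, y) Hy). simpl Nat.sub in H. rewrite sum_O, Ha1 in H.
  simpl Im in H. replace (INR 1 + 1) with 2 in H by (simpl; ring).
  eapply Rle_trans; [apply Req_le|exact H].
  f_equal. unfold INC. simpl INR. rewrite Cpow_1_r, !Cmult_1_l.
  f_equal. f_equal. generalize ((0, y) : C). intros z. Cfield.
Qed.

(** The inner sum for a divisor [d] has leading term [d a_d q^(n/d)]. For [d < n] the exponent is at
    least 2, which is negligible; only [d = n] reaches the order of [q]. *)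
Lemma hecke_leading_term (n : nat) :
  (1 <= n)%nat -> negligible (fun y => hecke N (2 * l) n f (0%R, y) - a n * qexp 1 (0%R, y))%C.
Proof.
  intros Hn.
  set (inner := fun d y => sum_n (G := C_AbelianMonoid)
                 (fun b => f ((INC (n / d) * (0%R, y) + INC b) / INC d)%C) (d - 1)).
  (* Apply [average_translates] at [w = (n/d) (iy) / d], of height [n y / d^2]. The condition
     [y >= n] makes this height at least 1. *)
  assert (Hinner : forall d, (1 <= d)%nat -> (n = (n / d) * d)%nat -> exists B,
            forall y, INR n <= y ->
            Cmod (inner d y - INC d * a d * qexp 1 (INC (n / d) * (0%R, y)))
              <= B * exp (- (2 * PI * (INR n / INR d * ((INR d + 1) / INR d)) * y))).
  { intros d Hd Hnd. destruct (average_translates f a d Hd Ha fourier_coeff_0) as [B HB].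
    assert (Hd0 : 0 < INR d) by (apply lt_0_INR; lia).
    assert (He1 : (1 <= n / d)%nat) by (destruct (n / d)%nat; lia).
    assert (Hnd' : INR n = INR (n / d) * INR d) by (rewrite <- mult_INR; now f_equal).
    apply le_INR in He1. change (INR 1) with 1 in He1.
    exists B. intros y Hy.
    set (e := (n / d)%nat) in *.
    set (w := (INC e * (0%R, y) / INC d)%C).
    assert (Hw : Im w = INR e * y / INR d).
    { unfold w, Cdiv. rewrite INC_inv by exact Hd. simpl. field. lra. }
    assert (H := HB w). rewrite Hw in H.
    replace (inner d y) with (sum_n (G := C_AbelianMonoid) (fun b => f (w + INC b / INC d)%C) (d
        - 1)).
    2: { apply sum_n_ext. intros b. f_equal. unfold w. change (n / d)%nat with e.
    generalize ((0, y) : C). intros z. Cfield. now apply INC_neq_0. }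
    replace (qexp 1 (INC e * (0%R, y))) with (qexp 1 w ^ d)%C.
    2: { rewrite <- qexp_mult_nat. f_equal. unfold w. generalize ((0, y) : C). intros z. Cfield.
    now apply INC_neq_0. }
    eapply Rle_trans; [apply H|apply Req_le].
    - apply (proj1 (Rle_div_r _ _ _ Hd0)). assert (INR d <= y) by nra. nra.
    - f_equal. f_equal. rewrite Hnd'. field. lra. }
  unfold hecke.
  set (term := fun d y => if andb (Nat.eqb (n mod d) 0) (Nat.eqb (Nat.gcd (n / d) N) 1)
        then (/ INC d ^ (2 * l) * inner d y)%C else RtoC 0).
  assert (Hsmall : forall d, (1 <= d <= n - 1)%nat -> negligible (term d)).
  { intros d Hd. unfold term.
    destruct (andb _ _) eqn:Hb; [|exact negligible_0].
    apply andb_prop in Hb as [Hb _]. apply Nat.eqb_eq in Hb.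
    apply negligible_scal.
    assert (Hnd : (n = (n / d) * d)%nat) by (assert (H := Nat.div_mod_eq n d); lia).
    destruct (Hinner d ltac:(lia) Hnd) as [B HB].
    assert (Hd0 : 0 < INR d) by (apply lt_0_INR; lia).
    assert (He : (2 <= n / d)%nat) by (destruct (n / d)%nat as [|[|]]; lia).
    assert (Hnd' : INR n = INR (n / d) * INR d) by (rewrite <- mult_INR; now f_equal).
    assert (He' : 2 <= INR (n / d)) by (apply le_INR in He; exact He).
    apply (negligible_ext (fun y => (inner d y - INC d * a d * qexp 1 (INC (n / d) * (0%R, y)))
              + (INC d * a d) * qexp 1 (INC (n / d) * (0%R, y)))%C _ 0); [intros; ring|].
    apply negligible_plus; [|apply negligible_scal].
    - apply (negligible_exp _ B (INR n / INR d * ((INR d + 1) / INR d)) (INR n)); [|exact HB].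
      rewrite Hnd'. replace (INR (n / d) * INR d / INR d * ((INR d + 1) / INR d))
        with (INR (n / d) + INR (n / d) / INR d) by (field; lra).
      assert (0 < INR (n / d) / INR d) by (apply Rdiv_lt_0_compat; lra). lra.
    - apply (negligible_exp _ 1 (INR (n / d)) 0); [lra|]. intros y _.
      rewrite qexp_mult_nat, Cmod_pow, Cmod_qexp_1, exp_mult_nat. simpl Im.
      apply Req_le. rewrite Rmult_1_l. f_equal. ring. }
  assert (Hn0 : INC n <> RtoC 0) by now apply INC_neq_0.
  assert (Hn1 : 0 < INR n) by (apply lt_0_INR; lia).
  destruct (Hinner n Hn ltac:(rewrite Nat.div_same by lia; lia)) as [B HB].
  assert (Hmain : negligible (fun y => inner n y - INC n * a n * qexp 1 (0%R, y))%C).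
  { apply (negligible_exp _ B (INR n / INR n * ((INR n + 1) / INR n)) (INR n)).
    - replace (INR n / INR n * ((INR n + 1) / INR n)) with (1 + / INR n) by (field; lra).
      assert (0 < / INR n) by now apply Rinv_0_lt_compat. lra.
    - intros y Hy. eapply Rle_trans; [|apply HB; exact Hy].
      rewrite Nat.div_same by lia. apply Req_le.
      replace (INC 1) with (RtoC 1) by reflexivity. now rewrite Cmult_1_l. }
  (* The normalizing factors of the term [d = n] cancel, so the coefficient of [q] is exactly
     [a n]. *)
  assert (Hpow : (INC n ^ (2 * l - 1) * (/ INC n ^ (2 * l) * INC n) = 1)%C).
  { replace (2 * l)%nat with (S (2 * l - 1)) at 2 by lia. rewrite Cpow_S.
    field. split; [now apply Cpow_nz|exact Hn0]. }
  apply (negligible_ext (fun y => INC n ^ (2 * l - 1) *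
      (sum_n_m (G := C_AbelianMonoid) (fun d => term d y) 1 (n - 1) +
       / INC n ^ (2 * l) * (inner n y - INC n * a n * qexp 1 (0%R, y))))%C _ 0).
  - intros y _.
    replace (sum_n_m (G := C_AbelianMonoid) _ 1 n)
      with (sum_n_m (G := C_AbelianMonoid) (fun d => term d y) 1 (n - 1) + / INC n ^ (2 * l) *
          inner n y)%C.
    + transitivity (INC n ^ (2 * l - 1) *
        (sum_n_m (G := C_AbelianMonoid) (fun d => term d y) 1 (n - 1) + / INC n ^ (2 * l) *
            inner n y)
        - (INC n ^ (2 * l - 1) * (/ INC n ^ (2 * l) * INC n)) * (a n * qexp 1 (0%R, y)))%C;
            [ring|].
      rewrite Hpow. ring.
    + symmetry.
      transitivity (sum_n_m (G := C_AbelianMonoid) (fun d => term d y) 1 (S (n - 1))).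
      { replace (S (n - 1)) with n by lia. reflexivity. }
      rewrite sum_n_Sm by lia. replace (S (n - 1)) with n by lia. f_equal. unfold term.
      (* At [d = n] the coprimality test reads [gcd (1, N) = 1], so this term is present even when
         [n] and [N] share a factor. *)
      rewrite Nat.Div0.mod_same, Nat.div_same by lia. simpl. reflexivity.
  - apply negligible_scal, negligible_plus.
    + apply negligible_sum_n_m. exact Hsmall.
    + now apply negligible_scal.
Qed.

(** Compare leading terms: both [T_n f - a n q] and [f - q] are negligible along the imaginary axis,
    so [(lambda - a n) q] is [o(q)]. *)
Lemma hecke_eigenvalue (n : nat) (lambda : C) :
  (1 <= n)%nat ->
  (forall z, 0 < Im z -> hecke N (2 * l) n f z = (lambda * f z)%C) -> lambda = a n.
Proof.
  intros Hn Hlam.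
  assert (H : negligible (fun y => (lambda - a n) * qexp 1 (0%R, y))%C).
  { apply (negligible_ext (fun y => (hecke N (2 * l) n f (0%R, y) - a n * qexp 1 (0%R, y)) +
        (- lambda) * (f (0%R, y) - qexp 1 (0%R, y)))%C _ 1).
    - intros y Hy. rewrite Hlam by (simpl; lra). ring.
    - apply negligible_plus; [now apply hecke_leading_term|].
      apply negligible_scal, form_leading_term. }
  assert (Hz : Cmod (lambda - a n) = 0).
  { apply Rle_antisym; [|apply Cmod_ge_0]. apply le_epsilon. intros eps Heps.
    destruct (H eps Heps) as [Y HY]. assert (H1 := HY Y (Rle_refl Y)).
    rewrite Cmod_mult, Cmod_qexp_1 in H1. simpl Im in H1.
    apply Rmult_le_reg_r in H1; [lra|apply exp_pos]. }
  apply Cmod_eq_0 in Hz. replace lambda with (lambda - a n + a n)%C by ring. rewrite Hz. ring.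
Qed.

(** With [n = d e], each of the [d] points lies at height [e y / d], where [|f| <= M (d / (e y))^l].
    After the factor [d^(-2l)] the divisor [d] contributes at most [d M / (n y)^l], and these add up
    to [sigma n]; the coprimality condition can only remove terms. *)
Lemma hecke_sup_bound (n : nat) (M : R) (z : C) :
  (1 <= n)%nat -> 0 < Im z -> (forall w, 0 < Im w -> Cmod (f w) * Im w ^ l <= M) ->
  Cmod (hecke N (2 * l) n f z) * Im z ^ l <= INR n ^ (l - 1) * sigma n * M.
Proof.
  intros Hn Hz HM.
  assert (HM0 : 0 <= M).
  { eapply Rle_trans; [|apply (HM z Hz)]. apply Rmult_le_pos; [apply Cmod_ge_0|apply pow_le;
      lra]. }
  assert (Hn0 : 0 < INR n) by (apply lt_0_INR; lia).
  set (y := Im z) in *.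
  assert (Hyl : 0 < y ^ l) by now apply pow_lt.
  assert (Hnl : 0 < INR n ^ l) by now apply pow_lt.
  unfold hecke. rewrite Cmod_mult, Cmod_pow.
  replace (Cmod (INC n)) with (INR n) by (unfold INC; rewrite Cmod_R, Rabs_right; lra).
  apply Rle_trans with (INR n ^ (2 * l - 1) * (sigma n * (M / (INR n ^ l * y ^ l))) * y ^ l).
  2: { apply Req_le. replace (2 * l - 1)%nat with (l - 1 + l)%nat by lia. rewrite pow_add.
  field. lra. }
  apply Rmult_le_compat_r; [lra|]. apply Rmult_le_compat_l; [apply pow_le; lra|].
  eapply Rle_trans; [apply Cmod_sum_n_m|].
  unfold sigma. rewrite Rmult_comm.
  match goal with |- _ <= ?c * sum_n_m ?u _ _ =>
    change (c * sum_n_m u 1 n) with (mult (K := R_Ring) c (sum_n_m (G := R_Ring) u 1 n)) end.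
  rewrite <- (sum_n_m_mult_l (K := R_Ring)).
  apply (sum_n_m_le (fun d => Cmod (if (Nat.eqb (n mod d) 0 && Nat.eqb (Nat.gcd (n / d) N)
      1)%bool then _ else _))).
  intros d. unfold mult; simpl.
  assert (Hq : 0 <= M / (INR n ^ l * y ^ l)).
  { apply Rmult_le_pos; [exact HM0|]. left; apply Rinv_0_lt_compat. now apply Rmult_lt_0_compat. }
  destruct (Nat.eqb (n mod d) 0) eqn:Hmod; simpl.
  2: { rewrite Cmod_0. lra. }
  destruct (Nat.eqb (Nat.gcd (n / d) N) 1); simpl.
  2: { rewrite Cmod_0. apply Rmult_le_pos; [exact Hq|apply pos_INR]. }
  apply Nat.eqb_eq in Hmod.
  (* [sum_n_m_le] asks for every index; [n mod 0 = n] is nonzero, which rules out [d = 0]. *)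
  assert (Hd : (1 <= d)%nat).
  { destruct d; [|lia]. simpl in Hmod. lia. }
  assert (Hnd : (n = (n / d) * d)%nat) by (assert (H := Nat.div_mod_eq n d); lia).
  assert (He : (1 <= n / d)%nat) by (destruct (n / d)%nat; lia).
  assert (Hnd' : INR n = INR (n / d) * INR d) by (rewrite <- mult_INR; now f_equal).
  set (e := (n / d)%nat) in *.
  assert (He0 : 0 < INR e) by (apply lt_0_INR; lia).
  assert (Hd0 : 0 < INR d) by (apply lt_0_INR; lia).
  assert (Hel : 0 < INR e ^ l) by now apply pow_lt.
  assert (Hdl : 0 < INR d ^ l) by now apply pow_lt.
  rewrite Cmod_mult, Cmod_inv by now apply Cpow_nz, INC_neq_0.
  change (Cpow (INC d) (l + (l + 0))) with (Cpow (INC d) (2 * l)).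
  rewrite Cmod_pow.
  replace (Cmod (INC d)) with (INR d) by (unfold INC; rewrite Cmod_R, Rabs_right; lra).
  apply Rle_trans with (/ INR d ^ (2 * l) * (INR d * (M * INR d ^ l / (INR e ^ l * y ^ l)))).
  - apply Rmult_le_compat_l; [left; now apply Rinv_0_lt_compat, pow_lt|].
    eapply Rle_trans; [apply Cmod_sum_n_m|].
    apply Rle_trans with (sum_n_m (fun _ => M * INR d ^ l / (INR e ^ l * y ^ l)) 0 (d - 1)).
    + apply sum_n_m_le. intros b.
      set (w := ((INC e * z + INC b) / INC d)%C).
      assert (Hw : Im w = INR e * y / INR d).
      { unfold w, Cdiv. rewrite INC_inv by exact Hd. unfold y. destruct z; simpl. field. lra. }
      assert (H := HM w). rewrite Hw in H.
      assert (Hwp : 0 < INR e * y / INR d).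
      { apply Rdiv_lt_0_compat; [apply Rmult_lt_0_compat|]; assumption. }
      specialize (H Hwp).
      replace ((INR e * y / INR d) ^ l) with (INR e ^ l * y ^ l / INR d ^ l) in H.
      2: { unfold Rdiv. rewrite !Rpow_mult_distr, pow_inv. reflexivity. }
      apply (Rmult_le_reg_r (INR e ^ l * y ^ l / INR d ^ l)).
      { apply Rdiv_lt_0_compat; [apply Rmult_lt_0_compat|]; assumption. }
      eapply Rle_trans; [exact H|]. apply Req_le. field. lra.
    + rewrite sum_n_m_const. replace (S (d - 1) - 0)%nat with d by lia. apply Rle_refl.
  - apply Req_le. rewrite Hnd', Rpow_mult_distr.
    replace (2 * l)%nat with (l + l)%nat by lia. rewrite pow_add. field. lra.
Qed.

Lemma coefficient_bound (n : nat) :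
  (1 <= n)%nat -> Cmod (a n) <= INR n ^ (l - 1) * sigma n.
Proof.
  intros Hn. destruct (Heig n Hn) as [lambda Hlam].
  rewrite <- (hecke_eigenvalue n lambda Hn Hlam).
  destruct (cusp_form_bounded N l f HN Hf) as [B HB].
  set (E := fun v => exists z, 0 < Im z /\ v = Cmod (f z) * Im z ^ l).
  destruct (completeness E) as [M [HM1 HM2]].
  - exists B. intros v [z [Hz ->]]. now apply HB.
  - exists (Cmod (f (0, 1)) * 1 ^ l), (0, 1). split; [simpl; lra|reflexivity].
  - assert (HM : forall w, 0 < Im w -> Cmod (f w) * Im w ^ l <= M).
    { intros w Hw. apply HM1. now exists w. }
    (* Dividing by the supremum requires it to be positive: high on the imaginary axis
       [|f - q| <= |q| / 2], so [f] does not vanish there. *)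
    assert (HMpos : 0 < M).
    { destruct (form_leading_term (1 / 2) ltac:(lra)) as [Y HY].
      set (y := Rmax Y 1). assert (Hy : 1 <= y) by apply Rmax_r.
      assert (H := HY y (Rmax_l _ _)).
      assert (H1 : Cmod (qexp 1 (0, y)) <= Cmod (f (0, y)) + Cmod (f (0, y) - qexp 1 (0, y))).
      { rewrite <- (Cmod_opp (f (0, y) - qexp 1 (0, y))).
        eapply Rle_trans; [|apply Cmod_triangle]. apply Req_le. f_equal. ring. }
      rewrite Cmod_qexp_1 in H1. simpl Im in H1.
      assert (H2 := exp_pos (- (2 * PI * y))).
      eapply Rlt_le_trans; [|apply (HM (0, y)); simpl; lra].
      apply Rmult_lt_0_compat; [lra|]. apply pow_lt. simpl; lra. }
    apply Rmult_le_reg_r with M; [exact HMpos|].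
    destruct (Req_dec (Cmod lambda) 0) as [H0|H0].
    { rewrite H0, Rmult_0_l. apply Rmult_le_pos; [|lra].
      apply Rmult_le_pos; [apply pow_le, pos_INR|apply sigma_ge_0]. }
    assert (Hl0 : 0 < Cmod lambda) by (assert (H := Cmod_ge_0 lambda); lra).
    rewrite Rmult_comm. apply (proj2 (Rle_div_r _ _ _ Hl0)).
    (* [M] is the least upper bound, so it is enough that [n^(l-1) sigma(n) M / |lambda|] is an
       upper bound. *)
    apply HM2. intros v [z [Hz ->]].
    apply (proj1 (Rle_div_r _ _ _ Hl0)).
    assert (H := hecke_sup_bound n M z Hn Hz HM).
    rewrite Hlam, Cmod_mult in H by exact Hz. lra.
Qed.

End HeckeBound.

(** * Sums of divisors *)

Ltac Rring := match goal with |- @eq _ ?x ?y => change (@eq R x y) end; ring.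

Lemma Rsum_n_m_S (u : nat -> R) (m : nat) :
  sum_n_m u 1 (S m) = sum_n_m u 1 m + u (S m).
Proof. apply (sum_n_Sm (G := R_AbelianMonoid)). lia. Qed.

Lemma Rsum_n_m_0 (u : nat -> R) : sum_n_m u 1 0 = 0.
Proof. apply (sum_n_m_zero (G := R_AbelianMonoid)). lia. Qed.

Lemma Rsum_n_m_le (u v : nat -> R) (m : nat) :
  (forall i, (1 <= i <= m)%nat -> u i <= v i) -> sum_n_m u 1 m <= sum_n_m v 1 m.
Proof.
  induction m as [|m IH]; intros H; [rewrite !Rsum_n_m_0; lra|].
  rewrite !Rsum_n_m_S. apply Rplus_le_compat; [apply IH; intros i Hi|]; apply H; lia.
Qed.

Lemma Rsum_n_m_scal (c : R) (u : nat -> R) (m : nat) :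
  sum_n_m (fun i => c * u i) 1 m = c * sum_n_m u 1 m.
Proof.
  induction m as [|m IH]; [rewrite !Rsum_n_m_0; Rring|].
  rewrite !Rsum_n_m_S, IH. Rring.
Qed.

Lemma Rsum_n_m_mono (u : nat -> R) (m p : nat) :
  (forall i, (1 <= i)%nat -> 0 <= u i) -> (m <= p)%nat -> sum_n_m u 1 m <= sum_n_m u 1 p.
Proof.
  intros Hu Hmp. induction Hmp as [|p _ IH]; [apply Rle_refl|].
  rewrite Rsum_n_m_S. assert (H := Hu (S p) ltac:(lia)). lra.
Qed.

Lemma Rsum_n_m_switch (u : nat -> nat -> R) (m p : nat) :
  sum_n_m (fun i => sum_n_m (u i) 1 p) 1 m =
  sum_n_m (fun j => sum_n_m (fun i => u i j) 1 m) 1 p.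
Proof.
  induction m as [|m IH].
  - rewrite Rsum_n_m_0.
    rewrite (sum_n_m_ext _ (fun _ => 0)) by (intros; apply Rsum_n_m_0).
    rewrite sum_n_m_const. Rring.
  - rewrite Rsum_n_m_S, IH.
    etransitivity.
    { symmetry. exact (sum_n_m_plus (G := R_AbelianMonoid)
                         (fun j => sum_n_m (fun i => u i j) 1 m) (u (S m)) 1 p). }
    apply sum_n_m_ext. intros j. now rewrite Rsum_n_m_S.
Qed.

(** Reindexing [n = d e], by induction on [m]: the quotient [m / d] grows exactly when [S m] is a
    multiple of [d]. *)
Lemma sum_multiples (g : nat -> R) (d m : nat) :
  (1 <= d)%nat ->
  sum_n_m (fun n => if Nat.eqb (n mod d) 0 then g n else 0) 1 m
  = sum_n_m (fun e => g (d * e)%nat) 1 (m / d).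
Proof.
  intros Hd. induction m as [|m IH].
  - rewrite Nat.Div0.div_0_l. now rewrite !Rsum_n_m_0.
  - rewrite Rsum_n_m_S, IH.
    assert (H1 := Nat.div_mod_eq m d). assert (H2 := Nat.mod_upper_bound m d ltac:(lia)).
    destruct (Nat.eq_dec (S (m mod d)) d) as [E|E].
    + assert (Hq : (S m = d * S (m / d) + 0)%nat) by nia.
      rewrite <- (Nat.div_unique (S m) d (S (m / d)) 0 ltac:(lia) Hq).
      rewrite <- (Nat.mod_unique (S m) d (S (m / d)) 0 ltac:(lia) Hq).
      simpl Nat.eqb. cbv iota. rewrite Rsum_n_m_S. do 2 f_equal. lia.
    + assert (Hq : (S m = d * (m / d) + S (m mod d))%nat) by lia.
      rewrite <- (Nat.div_unique (S m) d (m / d) (S (m mod d)) ltac:(lia) Hq).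
      rewrite <- (Nat.mod_unique (S m) d (m / d) (S (m mod d)) ltac:(lia) Hq).
      simpl Nat.eqb. cbv iota. Rring.
Qed.

(** [49/36 = 1 + 1/4 + 1/9]. For [n >= 4], [1/n^2 <= 1/(n - 1/2) - 1/(n + 1/2)], which telescopes to
    at most [2/7]; the induction carries the remainder [1/(m + 7/2)]. *)
Lemma sum_inv_sqr_le (m : nat) : sum_n_m (fun d => / INR d ^ 2) 1 m <= 49 / 36 + 2 / 7.
Proof.
  apply Rle_trans with (sum_n_m (fun d => / INR d ^ 2) 1 (3 + m)).
  { apply Rsum_n_m_mono; [|lia]. intros i Hi. left.
    apply Rinv_0_lt_compat, pow_lt, lt_0_INR. lia. }
  apply Rle_trans with (49 / 36 + 2 / 7 - / (INR m + 7 / 2)).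
  2: { assert (H := pos_INR m). assert (0 < / (INR m + 7 / 2)) by (apply Rinv_0_lt_compat; lra).
  lra. }
  induction m as [|m IH].
  - rewrite Nat.add_0_r, !Rsum_n_m_S, Rsum_n_m_0. simpl. lra.
  - rewrite Nat.add_succ_r, Rsum_n_m_S. rewrite !S_INR.
    rewrite plus_INR. replace (INR 3) with 3 by (simpl; Rring).
    assert (H := pos_INR m).
    assert (/ (3 + INR m + 1) ^ 2 <= / (INR m + 7 / 2) - / (INR m + 1 + 7 / 2)); [|lra].
    replace (/ (INR m + 7 / 2) - / (INR m + 1 + 7 / 2))
      with (/ ((INR m + 7 / 2) * (INR m + 9 / 2))) by (field; lra).
    apply Rinv_le_contravar; nra.
Qed.

(** [65/54 = 1 + 1/8 + 1/27 + 1/24]. For [n >= 4], [1/n^3 <= 1/((n-1) n (n+1))], a telescoping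
    series with sum [1/24]. *)
Lemma sum_inv_cube_le (m : nat) : sum_n_m (fun d => / INR d ^ 3) 1 m <= 65 / 54.
Proof.
  apply Rle_trans with (sum_n_m (fun d => / INR d ^ 3) 1 (3 + m)).
  { apply Rsum_n_m_mono; [|lia]. intros i Hi. left.
    apply Rinv_0_lt_compat, pow_lt, lt_0_INR. lia. }
  apply Rle_trans with (65 / 54 - / (2 * (INR m + 3) * (INR m + 4))).
  2: { assert (H := pos_INR m).
       assert (0 < / (2 * (INR m + 3) * (INR m + 4))) by (apply Rinv_0_lt_compat; nra). lra. }
  induction m as [|m IH].
  - rewrite Nat.add_0_r, !Rsum_n_m_S, Rsum_n_m_0. simpl. lra.
  - rewrite Nat.add_succ_r, Rsum_n_m_S. rewrite !S_INR.
    rewrite plus_INR. replace (INR 3) with 3 by (simpl; Rring).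
    assert (H := pos_INR m).
    assert (/ (3 + INR m + 1) ^ 3 <= / (2 * (INR m + 3) * (INR m + 4))
             - / (2 * (INR m + 1 + 3) * (INR m + 1 + 4))); [|lra].
    replace (/ (2 * (INR m + 3) * (INR m + 4)) - / (2 * (INR m + 1 + 3) * (INR m + 1 + 4)))
      with (/ ((INR m + 3) * (INR m + 4) * (INR m + 5))) by (field; lra).
    apply Rinv_le_contravar; nra.
Qed.

(* The sum is at most [zeta 2 * zeta 3 = 1.977...]. *)
Lemma sum_sigma_cube_le (m : nat) :
  sum_n_m (fun n => sigma n / INR n ^ 3) 1 m <= 1983 / 1000.
Proof.
  (* Extending the range of [d] to [1..m] makes the double sum rectangular. After the exchange,
     [n = d e] turns [d / n^3] into [d^(-2) e^(-3)]. *)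
  set (u := fun n d : nat => if Nat.eqb (n mod d) 0 then INR d / INR n ^ 3 else 0).
  apply Rle_trans with (sum_n_m (fun n => sum_n_m (u n) 1 m) 1 m).
  { apply Rsum_n_m_le. intros n Hn. unfold sigma, Rdiv.
    assert (Hn3 : 0 < / INR n ^ 3) by (apply Rinv_0_lt_compat, pow_lt, lt_0_INR; lia).
    rewrite Rmult_comm, <- Rsum_n_m_scal.
    rewrite (sum_n_m_ext _ (u n)).
    - apply Rsum_n_m_mono; [|lia]. intros d _. unfold u, Rdiv.
      destruct (Nat.eqb _ _); [|lra]. apply Rmult_le_pos; [apply pos_INR|lra].
    - intros d. unfold u. destruct (Nat.eqb _ _); unfold Rdiv; Rring. }
  rewrite Rsum_n_m_switch.
  apply Rle_trans with (sum_n_m (fun d => 65 / 54 * / INR d ^ 2) 1 m).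
  - apply Rsum_n_m_le. intros d Hd. unfold u.
    rewrite (sum_multiples (fun n => INR d / INR n ^ 3)) by lia.
    assert (Hd0 : 0 < INR d) by (apply lt_0_INR; lia).
    apply Rle_trans with (/ INR d ^ 2 * sum_n_m (fun e => / INR e ^ 3) 1 (m / d)).
    + rewrite <- Rsum_n_m_scal. apply Rsum_n_m_le. intros e He. apply Req_le.
      assert (He0 : 0 < INR e) by (apply lt_0_INR; lia).
      rewrite mult_INR. field. lra.
    + rewrite Rmult_comm. apply Rmult_le_compat_r; [|apply sum_inv_cube_le].
      left. now apply Rinv_0_lt_compat, pow_lt.
  (* [65/54 * (49/36 + 2/7) = 1.9822...]. *)
  - rewrite Rsum_n_m_scal. assert (H := sum_inv_sqr_le m). lra.
Qed.

(** The summand is [sigma(n) / n^l], at most [sigma(n) / n^3] since [l >= 3]; this is where [k >= 6]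
    is used. *)
Lemma sum_coefficient_bound (l m : nat) :
  (3 <= l)%nat ->
  sum_n_m (fun n => INR n ^ (l - 1) * sigma n / INR n ^ (2 * l - 1)) 1 m <= 1983 / 1000.
Proof.
  intros Hl. eapply Rle_trans; [|apply (sum_sigma_cube_le m)].
  apply Rsum_n_m_le. intros n Hn.
  assert (Hn0 : 1 <= INR n) by (apply (le_INR 1); lia).
  replace (2 * l - 1)%nat with ((l - 1) + ((l - 3) + 3))%nat by lia.
  assert (0 < INR n ^ (l - 1)) by (apply pow_lt; lra).
  assert (0 < INR n ^ 3) by (apply pow_lt; lra).
  assert (H1 : 1 <= INR n ^ (l - 3)) by (now apply pow_R1_Rle).
  rewrite !pow_add.
  replace (INR n ^ (l - 1) * sigma n / (INR n ^ (l - 1) * (INR n ^ (l - 3) * INR n ^ 3)))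
    with (sigma n / INR n ^ 3 * / INR n ^ (l - 3)) by (field; repeat split; lra).
  rewrite <- (Rmult_1_r (sigma n / INR n ^ 3)) at 2.
  apply Rmult_le_compat_l.
  - apply Rmult_le_pos; [apply sigma_ge_0|left; now apply Rinv_0_lt_compat].
  - rewrite <- Rinv_1. apply Rinv_le_contravar; lra.
Qed.

(** * Complex-valued integrals *)

(** Continuity is stated by coordinates so that the rules for complex products reduce to the real
    ones; [Ccont_continuous] converts it to the form that integration expects. *)
Definition Ccont (g : R -> C) (t : R) : Prop :=
  continuous (fun s => Re (g s)) t /\ continuous (fun s => Im (g s)) t.

Lemma Ccont_continuous (g : R -> C) (t : R) :
  Ccont g t -> continuous (U := C_R_CompleteNormedModule) g t.
Proof.
  intros [H1 H2].
  apply filterlim_locally. intros eps.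
  assert (A := proj1 (filterlim_locally _ _) H1 eps).
  assert (B := proj1 (filterlim_locally _ _) H2 eps).
  generalize (filter_and _ _ A B). apply filter_imp. intros s [Hs1 Hs2]. split; assumption.
Qed.

Lemma Ccont_const (c : C) (t : R) : Ccont (fun _ => c) t.
Proof. split; apply continuous_const. Qed.

Lemma Ccont_plus (g h : R -> C) (t : R) :
  Ccont g t -> Ccont h t -> Ccont (fun s => g s + h s)%C t.
Proof.
  intros [G1 G2] [H1 H2]; split.
  - exact (continuous_plus (fun s => Re (g s)) (fun s => Re (h s)) t G1 H1).
  - exact (continuous_plus (fun s => Im (g s)) (fun s => Im (h s)) t G2 H2).
Qed.

Lemma Ccont_mult (g h : R -> C) (t : R) :
  Ccont g t -> Ccont h t -> Ccont (fun s => g s * h s)%C t.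
Proof.
  intros [G1 G2] [H1 H2]; split.
  - exact (continuous_minus _ _ t
      (continuous_mult (fun s => Re (g s)) (fun s => Re (h s)) t G1 H1)
      (continuous_mult (fun s => Im (g s)) (fun s => Im (h s)) t G2 H2)).
  - exact (continuous_plus _ _ t
      (continuous_mult (fun s => Re (g s)) (fun s => Im (h s)) t G1 H2)
      (continuous_mult (fun s => Im (g s)) (fun s => Re (h s)) t G2 H1)).
Qed.

Lemma Ccont_minus (g h : R -> C) (t : R) :
  Ccont g t -> Ccont h t -> Ccont (fun s => g s - h s)%C t.
Proof.
  intros Hg [H1 H2]. apply Ccont_plus; [exact Hg|split].
  - exact (continuous_opp _ t H1).
  - exact (continuous_opp _ t H2).
Qed.

Lemma Ccont_pow (g : R -> C) (n : nat) (t : R) :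
  Ccont g t -> Ccont (fun s => g s ^ n)%C t.
Proof.
  intros Hg. induction n as [|n IH]; [apply Ccont_const|].
  exact (Ccont_mult _ _ t Hg IH).
Qed.

Lemma Ccont_RtoC (g : R -> R) (t : R) : continuous g t -> Ccont (fun s => RtoC (g s)) t.
Proof. intros H; split; [exact H|apply continuous_const]. Qed.

Lemma norm_C_R (z : C) : norm (V := C_R_NormedModule) z = Cmod z.
Proof.
  destruct z as [x y]. unfold Cmod; simpl.
  change (sqrt (Rabs x ^ 2 + Rabs y ^ 2) = sqrt (x ^ 2 + y ^ 2)). now rewrite !pow2_abs.
Qed.

Lemma continuous_Cmod (g : R -> C) (t : R) : Ccont g t -> continuous (fun s => Cmod (g s)) t.
Proof.
  intros H. apply Ccont_continuous in H.
  apply (continuous_ext (fun s => norm (V := C_R_NormedModule) (g s))).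
  - intros s. apply norm_C_R.
  - apply (continuous_comp (U := R_UniformSpace) (V := C_R_NormedModule) (W := R_UniformSpace)).
    + exact H.
    + apply filterlim_norm.
Qed.

Notation is_CInt := (is_RInt (V := C_R_CompleteNormedModule)).
Notation CInt := (RInt (V := C_R_CompleteNormedModule)).

Definition pcont (g : R -> C) : Prop := forall t, 0 < t -> Ccont g t.

Lemma Rmin_pos_le (a b t : R) : 0 < a -> 0 < b -> Rmin a b <= t -> 0 < t.
Proof. intros Ha Hb Ht. eapply Rlt_le_trans; [|exact Ht]. now apply Rmin_glb_lt. Qed.

Lemma pcont_is_CInt (g : R -> C) (a b : R) :
  pcont g -> 0 < a -> 0 < b -> is_CInt g a b (CInt g a b).
Proof.
  intros Hg Ha Hb. apply (RInt_correct (V := C_R_CompleteNormedModule)).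
  apply (ex_RInt_continuous (V := C_R_CompleteNormedModule)).
  intros t [Ht _]. apply Ccont_continuous, Hg. now apply (Rmin_pos_le a b).
Qed.

Lemma pos_is_RInt (g : R -> R) (a b : R) :
  (forall t, 0 < t -> continuous g t) -> 0 < a -> 0 < b -> is_RInt g a b (RInt g a b).
Proof.
  intros Hg Ha Hb. apply (RInt_correct (V := R_CompleteNormedModule)).
  apply (ex_RInt_continuous (V := R_CompleteNormedModule)).
  intros t [Ht _]. apply Hg. now apply (Rmin_pos_le a b).
Qed.

Lemma pcont_is_RInt_Cmod (g : R -> C) (a b : R) :
  pcont g -> 0 < a -> 0 < b ->
  is_RInt (fun t => Cmod (g t)) a b (RInt (fun t => Cmod (g t)) a b).
Proof. intros Hg. apply pos_is_RInt. intros t Ht. now apply continuous_Cmod, Hg. Qed.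

Lemma Cmod_CInt_le (g : R -> C) (h : R -> R) (a b : R) (l : C) (m : R) :
  a <= b -> (forall t, a <= t <= b -> Cmod (g t) <= h t) ->
  is_CInt g a b l -> is_RInt h a b m -> Cmod l <= m.
Proof.
  intros Hab Hgh Hg Hh. rewrite <- norm_C_R.
  apply (norm_RInt_le (V := C_R_NormedModule) g h a b); try assumption.
  intros t Ht. rewrite norm_C_R. now apply Hgh.
Qed.

Lemma is_CInt_Cmult (c : C) (g : R -> C) (a b : R) (l : C) :
  is_CInt g a b l -> is_CInt (fun t => c * g t)%C a b (c * l)%C.
Proof.
  intros H.
  assert (H1 : is_RInt (fun t => Re (g t)) a b (Re l)) by
    exact (is_RInt_fct_extend_fst (U := R_NormedModule) (V := R_NormedModule) _ _ _ _ H).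
  assert (H2 : is_RInt (fun t => Im (g t)) a b (Im l)) by
    exact (is_RInt_fct_extend_snd (U := R_NormedModule) (V := R_NormedModule) _ _ _ _ H).
  apply (is_RInt_fct_extend_pair (U := R_NormedModule) (V := R_NormedModule)
           (fun t => c * g t)%C a b).
  - exact (is_RInt_minus _ _ a b _ _ (is_RInt_scal _ a b (Re c) _ H1) (is_RInt_scal _ a b (Im c)
        _ H2)).
  - exact (is_RInt_plus _ _ a b _ _ (is_RInt_scal _ a b (Re c) _ H2) (is_RInt_scal _ a b (Im c)
        _ H1)).
Qed.

Lemma is_RInt_zero (a b : R) : is_RInt (fun _ => 0) a b 0.
Proof.
  exact (eq_ind _ (fun l : R => is_RInt (fun _ => 0) a b l)
           (is_RInt_const (V := R_NormedModule) a b 0) 0 (Rmult_0_r (b - a))).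
Qed.

Lemma is_CInt_RtoC (g : R -> R) (a b l : R) :
  is_RInt g a b l -> is_CInt (fun t => RtoC (g t)) a b (RtoC l).
Proof.
  intros H.
  apply (is_RInt_fct_extend_pair (U := R_NormedModule) (V := R_NormedModule)
           (fun t => RtoC (g t)) a b); [exact H|apply is_RInt_zero].
Qed.

Lemma is_CInt_minus (g h : R -> C) (a b : R) (l m : C) :
  is_CInt g a b l -> is_CInt h a b m -> is_CInt (fun t => g t - h t)%C a b (l - m)%C.
Proof. exact (is_RInt_minus (V := C_R_NormedModule) g h a b l m). Qed.

Definition is_CInt_improper (g : R -> C) (l : C) : Prop :=
  is_RInt_gen (V := C_R_CompleteNormedModule) g (at_right 0) (Rbar_locally p_infty) l.

Lemma improper_unique (g : R -> C) (l : C) :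
  is_CInt_improper g l ->
  RInt_gen (V := C_R_CompleteNormedModule) g (at_right 0) (Rbar_locally p_infty) = l.
Proof. intros H. apply (is_RInt_gen_unique (V := C_R_CompleteNormedModule)), H. Qed.

Lemma improper_plus (g h : R -> C) (l m : C) :
  is_CInt_improper g l -> is_CInt_improper h m ->
  is_CInt_improper (fun t => g t + h t)%C (l + m)%C.
Proof. exact (is_RInt_gen_plus (V := C_R_NormedModule) g h l m). Qed.

Lemma improper_ext (g h : R -> C) (l : C) :
  (forall t, g t = h t) -> is_CInt_improper g l -> is_CInt_improper h l.
Proof.
  intros E. refine (is_RInt_gen_ext (V := C_R_NormedModule) (Fa := at_right 0)
                      (Fb := Rbar_locally p_infty) g h l _).
  apply filter_forall. intros ab t _. apply E.
Qed.

(** Absolute convergence implies convergence. The second conclusion restates the limit with one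
    [delta] for both ends, to be confronted with estimates on compact intervals. *)
Lemma improper_convergence (g : R -> C) (B : R) :
  pcont g -> (forall a b, 0 < a <= b -> RInt (fun t => Cmod (g t)) a b <= B) ->
  exists l, is_CInt_improper g l /\
    forall eps, 0 < eps -> exists delta, 0 < delta /\
      forall a b, 0 < a < delta -> / delta < b -> Cmod (CInt g a b - l) < eps.
Proof.
  intros Hg HB.
  set (G := fun a b => RInt (fun t => Cmod (g t)) a b).
  set (E := fun v => exists a b, 0 < a <= b /\ v = G a b).
  destruct (completeness E) as [S [HS1 HS2]].
  { exists B. intros v [a [b [Hab ->]]]. now apply HB. }
  { exists (G 1 1), 1, 1. split; [lra|reflexivity]. }
  (* Choose [[a0, b0]] whose absolute integral is within [eps] of the supremum [S]. A larger
     interval adds absolute mass less than [eps], hence changes the integral of [g] by less than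
     [eps]. *)
  assert (Hclose : forall eps, 0 < eps -> exists a0 b0, 0 < a0 <= b0 /\
     forall a b, 0 < a <= a0 -> b0 <= b -> Cmod (CInt g a b - CInt g a0 b0) < eps).
  { intros eps Heps.
    destruct (classic (exists a b, 0 < a <= b /\ S - eps < G a b)) as [[a0 [b0 [H0 HG]]]|Hno].
    2: { exfalso. assert (S <= S - eps); [|lra]. apply HS2. intros v [a [b [Hab ->]]].
         apply Rnot_lt_le. intros Hlt. apply Hno. now exists a, b. }
    exists a0, b0. split; [exact H0|]. intros a b Ha Hb.
    assert (HGab : G a b <= S) by (apply HS1; exists a, b; split; [lra|reflexivity]).
    assert (I1 : is_CInt g a b (CInt g a a0 + CInt g a0 b0 + CInt g b0 b)%C).
    { apply (is_RInt_Chasles (V := C_R_NormedModule) g a b0 b);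
        [apply (is_RInt_Chasles (V := C_R_NormedModule) g a a0 b0)|]; apply pcont_is_CInt;
          (assumption || lra). }
    rewrite (is_RInt_unique (V := C_R_CompleteNormedModule) _ _ _ _ I1).
    assert (I2 : is_RInt (fun t => Cmod (g t)) a b (G a a0 + G a0 b0 + G b0 b)).
    { apply (is_RInt_Chasles (V := R_NormedModule) _ a b0 b);
        [apply (is_RInt_Chasles (V := R_NormedModule) _ a a0 b0)|]; apply pcont_is_RInt_Cmod;
          (assumption || lra). }
    assert (HG2 : G a b = G a a0 + G a0 b0 + G b0 b) by
      exact (is_RInt_unique (V := R_CompleteNormedModule) _ _ _ _ I2).
    replace (CInt g a a0 + CInt g a0 b0 + CInt g b0 b - CInt g a0 b0)%C
      with (CInt g a a0 + CInt g b0 b)%C by Cring.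
    eapply Rle_lt_trans; [apply Cmod_triangle|].
    assert (J1 : Cmod (CInt g a a0) <= G a a0).
    { apply (Cmod_CInt_le g (fun t => Cmod (g t)) a a0); [lra|intros; apply Rle_refl| |].
      - apply pcont_is_CInt; (assumption || lra).
      - apply pcont_is_RInt_Cmod; (assumption || lra). }
    assert (J2 : Cmod (CInt g b0 b) <= G b0 b).
    { apply (Cmod_CInt_le g (fun t => Cmod (g t)) b0 b); [lra|intros; apply Rle_refl| |].
      - apply pcont_is_CInt; (assumption || lra).
      - apply pcont_is_RInt_Cmod; (assumption || lra). }
    lra. }
  assert (Hset : forall a0 b0, 0 < a0 -> filter_prod (at_right 0) (Rbar_locally p_infty)
            (fun ab => 0 < fst ab <= a0 /\ b0 <= snd ab)).
  { intros a0 b0 Ha0. apply (Filter_prod _ _ _ (fun a => 0 < a <= a0) (fun b => b0 <= b)).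
    - exists (mkposreal a0 Ha0). intros a Ha Ha1.
      assert (H := proj1 (Rabs_def2 _ _ Ha)). simpl in H.
      unfold minus, plus, opp in H; simpl in H. lra.
    - exists b0. intros b Hb. lra.
    - intros a b Ha Hb. now split. }
  assert (Hlim : exists l : C_R_CompleteNormedModule,
     filterlim (fun ab => CInt g (fst ab) (snd ab))
       (filter_prod (at_right 0) (Rbar_locally p_infty)) (locally l)).
  { apply (filterlim_locally_cauchy (U := C_R_CompleteNormedModule)). intros eps.
    destruct (Hclose (eps / 2)) as [a0 [b0 [H0 HC]]]; [assert (H := cond_pos eps); lra|].
    exists (fun ab => 0 < fst ab <= a0 /\ b0 <= snd ab). split; [apply Hset; lra|].
    intros u v [Hu1 Hu2] [Hv1 Hv2].
    apply (norm_compat1 (V := C_R_NormedModule)). rewrite norm_C_R.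
    assert (A := HC _ _ Hu1 Hu2). assert (A' := HC _ _ Hv1 Hv2).
    apply Rle_lt_trans with (Cmod ((CInt g (fst v) (snd v) - CInt g a0 b0)
                                   + - (CInt g (fst u) (snd u) - CInt g a0 b0))%C).
    { apply Req_le. f_equal.
      change ((CInt g (fst v) (snd v) - CInt g (fst u) (snd u))%C =
              ((CInt g (fst v) (snd v) - CInt g a0 b0)
                + - (CInt g (fst u) (snd u) - CInt g a0 b0))%C). Cring. }
    eapply Rle_lt_trans; [apply Cmod_triangle|]. rewrite Cmod_opp.
    apply Rlt_le_trans with (eps / 2 + eps / 2); [now apply Rplus_lt_compat|lra]. }
  destruct Hlim as [l Hl]. exists l. split.
  - apply (filterlimi_lim_ext_loc (fun ab => CInt g (fst ab) (snd ab))); [|exact Hl].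
    generalize (Hset 1 1 Rlt_0_1). apply filter_imp. intros [a b] [Ha Hb]; simpl in *.
    apply pcont_is_CInt; (assumption || lra).
  - intros eps Heps.
    assert (H := proj1 (filterlim_locally_ball_norm (K := R_AbsRing) (U := C_R_NormedModule)
               _ _) Hl (mkposreal eps Heps)).
    destruct H as [P Q HP HQ HPQ].
    destruct HP as [d Hd]. destruct HQ as [M HM].
    assert (Hdp := cond_pos d).
    assert (Hm : 0 < Rmax M 1) by (eapply Rlt_le_trans; [apply Rlt_0_1|apply Rmax_r]).
    (* [Rmax M 1] is positive whatever the sign of [M], so [b > / delta] forces [b > M]. *)
    exists (Rmin d (/ Rmax M 1)). split.
    { apply Rmin_glb_lt; [exact Hdp|now apply Rinv_0_lt_compat]. }
    intros a b Ha Hb. rewrite <- norm_C_R. apply (HPQ a b).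
    + apply Hd; [|lra]. assert (a < d) by (eapply Rlt_le_trans; [apply Ha|apply Rmin_l]).
      unfold ball; simpl. unfold AbsRing_ball, abs, minus, plus, opp; simpl.
      apply Rabs_def1; lra.
    + apply HM. eapply Rle_lt_trans; [|exact Hb].
      eapply Rle_trans; [apply (Rmax_l M 1)|].
      rewrite <- (Rinv_inv (Rmax M 1)) at 1. apply Rinv_le_contravar; [|apply Rmin_r].
      apply Rmin_glb_lt; [exact Hdp|now apply Rinv_0_lt_compat].
Qed.

(** * Gamma integrals *)

Definition gamma_density (s : R) (w : nat) (u : R) : R := exp (- (s * u)) * u ^ w.

(* [- exp (- s u) * gamma_poly s w u] is an antiderivative of [gamma_density s w]. *)
Fixpoint gamma_poly (s : R) (w : nat) (u : R) : R :=
  match w with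
  | O => / s
  | S n => u ^ S n / s + INR (S n) / s * gamma_poly s n u
  end.

(** With [P = gamma_poly s w], this is the antiderivative property, as the derivative of
    [- exp (- s u) P] is [exp (- s u) (s P - P')]. *)
Lemma is_derive_gamma_poly (s : R) (w : nat) (u : R) :
  0 < s -> is_derive (gamma_poly s w) u (s * gamma_poly s w u - u ^ w).
Proof.
  intros Hs. induction w as [|w IH].
  - simpl. replace (s * / s - 1) with 0 by (field; lra). apply @is_derive_const.
  - apply (is_derive_ext (fun u => u ^ S w / s + INR (S w) / s * gamma_poly s w u));
      [reflexivity|].
    auto_derive.
    + now exists (s * gamma_poly s w u - u ^ w).
    + replace (Derive (fun x => gamma_poly s w x) u) with (s * gamma_poly s w u - u ^ w)
        by (symmetry; now apply is_derive_unique).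
      change (gamma_poly s (S w) u) with (u ^ S w / s + INR (S w) / s * gamma_poly s w u).
      change (match w with 0%nat => 1 | S _ => INR w + 1 end) with (INR (S w)).
      rewrite <- tech_pow_Rmult. simpl Init.Nat.pred. field. lra.
Qed.

Lemma gamma_poly_ge_0 (s : R) (w : nat) (u : R) : 0 < s -> 0 <= u -> 0 <= gamma_poly s w u.
Proof.
  intros Hs Hu. assert (H0 : 0 < / s) by now apply Rinv_0_lt_compat.
  induction w as [|w IH]; [simpl; lra|].
  change (0 <= u ^ S w / s + INR (S w) / s * gamma_poly s w u).
  assert (H1 := pow_le u (S w) Hu). assert (H2 := pos_INR (S w)).
  apply Rplus_le_le_0_compat; [apply Rmult_le_pos; lra|].
  apply Rmult_le_pos; [apply Rmult_le_pos; lra|exact IH].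
Qed.

Lemma gamma_poly_0 (s : R) (w : nat) :
  0 < s -> gamma_poly s w 0 = INR (fact w) / s ^ S w.
Proof.
  intros Hs. induction w as [|w IH].
  - simpl. field. lra.
  - change (gamma_poly s (S w) 0) with (0 ^ S w / s + INR (S w) / s * gamma_poly s w 0).
    rewrite IH. change (fact (S w)) with (S w * fact w)%nat. rewrite mult_INR.
    rewrite pow_ne_zero by lia. rewrite <- (tech_pow_Rmult s (S w)). field.
    split; [|lra]. apply pow_nonzero. lra.
Qed.

Lemma gamma_poly_growth (s alpha : R) (w : nat) :
  0 < s -> 0 < alpha ->
  exists D, 0 <= D /\ forall u, 0 <= u -> gamma_poly s w u <= D * exp (alpha * u).
Proof.
  intros Hs Ha. assert (H0 : 0 < / s) by now apply Rinv_0_lt_compat.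
  induction w as [|w [D [HD IH]]].
  - exists (/ s). split; [lra|]. intros u Hu. simpl.
    assert (H1 := exp_ineq1_le (alpha * u)). assert (0 <= alpha * u) by (apply Rmult_le_pos; lra).
    rewrite <- (Rmult_1_r (/ s)) at 1. apply Rmult_le_compat_l; lra.
  - destruct (pow_le_exp (S w) alpha Ha) as [D' [HD' H]].
    assert (HS := pos_INR (S w)).
    exists (D' / s + INR (S w) / s * D). split.
    { apply Rplus_le_le_0_compat; [apply Rmult_le_pos; lra|].
      apply Rmult_le_pos; [apply Rmult_le_pos; lra|exact HD]. }
    intros u Hu.
    change (u ^ S w / s + INR (S w) / s * gamma_poly s w u <=
            (D' / s + INR (S w) / s * D) * exp (alpha * u)).
    assert (A := H u Hu). assert (A' := IH u Hu).
    apply (Rmult_le_compat_r (/ s)) in A; [|lra].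
    apply (Rmult_le_compat_l (INR (S w) / s)) in A'; [|apply Rmult_le_pos; lra].
    unfold Rdiv in *. lra.
Qed.

Definition gamma_primitive (s : R) (w : nat) (u : R) : R :=
  - (exp (- (s * u)) * gamma_poly s w u).

Lemma continuous_gamma_density (s : R) (w : nat) (u : R) : continuous (gamma_density s w) u.
Proof.
  apply (ex_derive_continuous (K := R_AbsRing) (V := R_NormedModule)). unfold gamma_density.
  auto_derive. trivial.
Qed.

Lemma is_RInt_gamma (s : R) (w : nat) (a b : R) :
  0 < s -> is_RInt (gamma_density s w) a b (gamma_primitive s w b - gamma_primitive s w a).
Proof.
  intros Hs. apply (is_RInt_derive (V := R_CompleteNormedModule) (gamma_primitive s w)).
  - intros u _. unfold gamma_primitive, gamma_density. auto_derive.
    + exists (s * gamma_poly s w u - u ^ w). now apply is_derive_gamma_poly.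
    + replace (Derive (fun x => gamma_poly s w x) u) with (s * gamma_poly s w u - u ^ w)
        by (symmetry; now apply is_derive_unique, is_derive_gamma_poly). ring.
  - intros u _. apply continuous_gamma_density.
Qed.

Lemma gamma_density_ge_0 (s : R) (w : nat) (u : R) : 0 <= u -> 0 <= gamma_density s w u.
Proof. intros Hu. apply Rmult_le_pos; [left; apply exp_pos|now apply pow_le]. Qed.

Lemma gamma_primitive_0 (s : R) (w : nat) :
  0 < s -> gamma_primitive s w 0 = - (INR (fact w) / s ^ S w).
Proof.
  intros Hs. unfold gamma_primitive. rewrite gamma_poly_0 by exact Hs.
  rewrite Rmult_0_r, Ropp_0, exp_0. ring.
Qed.

(** The right-hand side is the full integral over [(0, oo)]; the parts below [a] and above [b] are
    nonnegative. *)
Lemma incomplete_gamma_le (s : R) (w : nat) (a b : R) :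
  0 < s -> 0 <= a <= b ->
  gamma_primitive s w b - gamma_primitive s w a <= INR (fact w) / s ^ S w.
Proof.
  intros Hs Hab.
  assert (H : 0 <= gamma_primitive s w a - gamma_primitive s w 0).
  { apply (is_RInt_ge_0 (gamma_density s w) 0 a); [lra|now apply is_RInt_gamma|].
    intros u Hu. apply gamma_density_ge_0. lra. }
  rewrite gamma_primitive_0 in H by exact Hs.
  assert (gamma_primitive s w b <= 0); [|lra].
  unfold gamma_primitive.
  assert (0 <= exp (- (s * b)) * gamma_poly s w b); [|lra].
  apply Rmult_le_pos; [left; apply exp_pos|]. apply gamma_poly_ge_0; lra.
Qed.

Lemma incomplete_gamma_limit (s : R) (w : nat) (eta : R) :
  0 < s -> 0 < eta -> exists delta, 0 < delta /\ forall a b, 0 <= a <= delta -> / delta <= b ->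
    INR (fact w) / s ^ S w - eta <= gamma_primitive s w b - gamma_primitive s w a.
Proof.
  intros Hs He.
  destruct (gamma_poly_growth s (s / 2) w Hs ltac:(lra)) as [D [HD HDg]].
  (* The part above [b] is at most [D exp (- s b / 2)], and [b >= / d3] makes it at most [eta / 2].
     Below [delta <= 1] the density is at most 1, so the part below [a] is at most
     [a <= eta / 2]. *)
  set (d3 := s * eta / (4 * D + 1)).
  assert (Hd3 : 0 < d3) by (apply Rdiv_lt_0_compat; [now apply Rmult_lt_0_compat|lra]).
  exists (Rmin (Rmin 1 (eta / 2)) d3). set (delta := Rmin _ _).
  assert (Hd : 0 < delta) by (repeat apply Rmin_glb_lt; lra).
  assert (E1 : delta <= 1) by (eapply Rle_trans; apply Rmin_l).
  assert (E2 : delta <= eta / 2) by (eapply Rle_trans; [apply Rmin_l|apply Rmin_r]).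
  assert (E3 : delta <= d3) by apply Rmin_r.
  split; [exact Hd|]. intros a b Ha Hb.
  assert (H1 : gamma_primitive s w a - gamma_primitive s w 0 <= a - 0).
  { apply (is_RInt_le (gamma_density s w) (fun _ => 1) 0 a); [lra|now apply is_RInt_gamma| |].
    - replace (a - 0) with (scal (a - 0) 1) by (apply Rmult_1_r).
      apply (is_RInt_const (V := R_NormedModule)).
    - intros u Hu. unfold gamma_density. rewrite <- (Rmult_1_l 1).
      apply Rmult_le_compat; [left; apply exp_pos|apply pow_le; lra| |].
      + rewrite <- exp_0. apply exp_monotone. assert (0 <= s * u) by (apply Rmult_le_pos; lra).
        lra.
      + rewrite <- (pow1 w). apply pow_incr. lra. }
  rewrite gamma_primitive_0 in H1 by exact Hs.
  assert (Hid : 0 < / delta) by now apply Rinv_0_lt_compat.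
  assert (H2 : exp (- (s * b)) * gamma_poly s w b <= eta / 2).
  { apply Rle_trans with (exp (- (s * b)) * (D * exp (s / 2 * b))).
    { apply Rmult_le_compat_l; [left; apply exp_pos|]. apply HDg. lra. }
    replace (exp (- (s * b)) * (D * exp (s / 2 * b))) with (D * exp (- (s / 2 * b))).
    2: { replace (- (s / 2 * b)) with (- (s * b) + s / 2 * b) by field. rewrite exp_plus. ring. }
    rewrite exp_Ropp. apply (Rmult_le_reg_r (exp (s / 2 * b))); [apply exp_pos|].
    rewrite Rmult_assoc, Rinv_l, Rmult_1_r by apply Rgt_not_eq, exp_pos.
    assert (Hx := exp_ineq1_le (s / 2 * b)).
    apply Rle_trans with (eta / 2 * (s / 2 * b)); [|apply Rmult_le_compat_l; lra].
    assert (Hb3 : / d3 <= b).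
    { eapply Rle_trans; [|exact Hb]. now apply Rinv_le_contravar. }
    apply (Rmult_le_compat_l (s * eta / 4)) in Hb3; [|left;
      assert (0 < s * eta) by (now apply Rmult_lt_0_compat); lra].
    replace (s * eta / 4 * / d3) with ((4 * D + 1) / 4) in Hb3 by (unfold d3; field; lra).
    replace (eta / 2 * (s / 2 * b)) with (s * eta / 4 * b) by field. lra. }
  unfold gamma_primitive at 1. lra.
Qed.

(** Substitution [t = 1 / (c^2 u)]: reversing the orientation absorbs the sign of the derivative. It
    is stated for any [V] to serve both the integral of [f] and that of its modulus. *)
Lemma RInt_inversion (V : CompleteNormedModule R_AbsRing) (g : R -> V) (c a b : R) :
  0 < c -> 0 < a -> 0 < b -> (forall t, 0 < t -> continuous g t) ->
  is_RInt (fun u => scal (/ (c ^ 2 * u ^ 2)) (g (/ (c ^ 2 * u)))) a b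
    (RInt g (/ (c ^ 2 * b)) (/ (c ^ 2 * a))).
Proof.
  intros Hc Ha Hb Hg. assert (Hc2 : 0 < c ^ 2) by now apply pow_lt.
  assert (Hpos : forall u, Rmin a b <= u -> 0 < u) by (intros u; now apply Rmin_pos_le).
  assert (H : is_RInt (fun u => scal (- / (c ^ 2 * u ^ 2)) (g (/ (c ^ 2 * u)))) a b
                (RInt g (/ (c ^ 2 * a)) (/ (c ^ 2 * b)))).
  { apply (is_RInt_comp g (fun u => / (c ^ 2 * u)) (fun u => - / (c ^ 2 * u ^ 2)) a b).
    - intros u [Hu _]. apply Hg, Rinv_0_lt_compat, Rmult_lt_0_compat; [exact Hc2|now apply Hpos].
    - intros u [Hu _]. assert (Hu0 := Hpos u Hu). split.
      + auto_derive.
        * apply Rgt_not_eq. now apply Rmult_lt_0_compat.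
        * field. lra.
      + apply (ex_derive_continuous (K := R_AbsRing) (V := R_NormedModule)). auto_derive.
        apply Rgt_not_eq, Rmult_lt_0_compat; [nra|nra]. }
  assert (Hsw : ex_RInt g (/ (c ^ 2 * a)) (/ (c ^ 2 * b))).
  { apply ex_RInt_continuous. intros t [Ht _]. apply Hg.
    eapply Rmin_pos_le; [| |exact Ht]; now apply Rinv_0_lt_compat, Rmult_lt_0_compat. }
  rewrite <- opp_RInt_swap by exact Hsw.
  apply (is_RInt_ext (fun u => opp (scal (- / (c ^ 2 * u ^ 2)) (g (/ (c ^ 2 * u)))))).
  - intros u _. rewrite <- scal_opp_l. f_equal. unfold opp; simpl. ring.
  - exact (is_RInt_opp _ a b _ H).
Qed.

(** * Moments along vertical lines *)

(** The integral of [exp (- 2 pi u) u^w] over [(0, oo)], that is, the absolute [w]-th moment of [q]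
    on a vertical line. *)
Definition gamma_2pi (w : nat) : R := INR (fact w) / (2 * PI) ^ S w.

Lemma gamma_2pi_pos (w : nat) : 0 < gamma_2pi w.
Proof.
  assert (HPI := PI_RGT_0). apply Rdiv_lt_0_compat; [apply lt_0_INR, lt_O_fact|].
  apply pow_lt; lra.
Qed.

Lemma sigma_1 : sigma 1 = 1.
Proof. unfold sigma. rewrite sum_n_n. reflexivity. Qed.

Lemma holomorphic_pcont (f : C -> C) (x : R) :
  holomorphic_on_H f -> pcont (fun t => f (x, t)).
Proof.
  intros Hf t Ht.
  assert (H := ex_derive_continuous (K := C_AbsRing) (V := C_NormedModule) f (x, t) (Hf (x, t)
      Ht)).
  assert (Hc : continuous (U := C_UniformSpace) (fun s => f (x, s)) t).
  { apply (continuous_comp (U := R_UniformSpace) (V := AbsRing_UniformSpace C_AbsRing)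
             (W := C_UniformSpace) (fun s => (x, s)) f); [|exact H].
    apply filterlim_locally. intros eps. exists eps. intros s Hs.
    change (Cmod ((x, s) - (x, t))%C < eps).
    replace ((x, s) - (x, t))%C with (0, s - t) by (unfold Cminus, Cplus, Copp; simpl; f_equal;
      ring).
    eapply Rle_lt_trans; [|exact Hs]. unfold Cmod. simpl.
    replace (0 * (0 * 1) + (s - t) * ((s - t) * 1)) with ((s - t)²) by (unfold Rsqr; ring).
    rewrite sqrt_Rsqr_abs. apply Rle_refl. }
  split.
  - apply (continuous_comp (U := R_UniformSpace) (V := C_UniformSpace) (W := R_UniformSpace)
             (fun s => f (x, s)) fst); [exact Hc|].
    destruct (f (x, t)). apply continuous_fst.
  - apply (continuous_comp (U := R_UniformSpace) (V := C_UniformSpace) (W := R_UniformSpace)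
             (fun s => f (x, s)) snd); [exact Hc|].
    destruct (f (x, t)). apply continuous_snd.
Qed.

Lemma is_RInt_sum_gamma (b s : nat -> R) (w m : nat) (e r : R) :
  (forall n, (2 <= n)%nat -> 0 < s n) ->
  is_RInt (fun u => sum_n_m (fun n => b n * gamma_density (s n) w u) 2 m) e r
    (sum_n_m (fun n => b n * (gamma_primitive (s n) w r - gamma_primitive (s n) w e)) 2 m).
Proof.
  intros Hs.
  assert (Hz : forall m, (m < 2)%nat -> forall v : nat -> R, sum_n_m v 2 m = 0).
  { intros p Hp v. now apply (sum_n_m_zero (G := R_AbelianMonoid)). }
  induction m as [|m IH]; [|destruct m as [|m]].
  1,2: rewrite Hz by lia; apply (is_RInt_ext (fun _ => 0));
    [intros u _; now rewrite Hz by lia|apply is_RInt_zero].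
  rewrite sum_n_Sm by lia.
  apply (is_RInt_ext (fun u => plus (sum_n_m (fun n => b n * gamma_density (s n) w u) 2 (S m))
           (scal (b (S (S m))) (gamma_density (s (S (S m))) w u)))).
  - intros u _. rewrite (sum_n_Sm _ 2 (S m)) by lia. reflexivity.
  - apply (is_RInt_plus (V := R_NormedModule)); [exact IH|].
    apply (is_RInt_scal (V := R_NormedModule)). apply is_RInt_gamma, Hs. lia.
Qed.

Lemma Rsum_2_le (u v : nat -> R) (m : nat) :
  (forall n, (2 <= n)%nat -> u n <= v n) -> sum_n_m u 2 m <= sum_n_m v 2 m.
Proof.
  intros H.
  (* Replacing [u] by [min (u, v)], which agrees with it on the range, gives an inequality valid at
     every index. *)
  rewrite (sum_n_m_ext_loc u (fun n => Rmin (u n) (v n))).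
  - apply sum_n_m_le. intros n. apply Rmin_r.
  - intros n Hn. symmetry. apply Rmin_left, H. lia.
Qed.

Section MomentBounds.
Context (N l : nat) (f : C -> C) (a : nat -> C).
Context (HN : (1 <= N)%nat) (Hl : (3 <= l)%nat) (Hf : cusp_form N (2 * l) f).
Context (Ha : fourier_expansion 1 f a) (Ha1 : a 1%nat = 1).
Context (Heig : hecke_eigenform N (2 * l) f).

Let w := (2 * l - 2)%nat.
Let W := gamma_2pi w.
Let b (n : nat) : R := INR n ^ (l - 1) * sigma n.

Lemma form_pcont (x : R) : pcont (fun t => f (x, t)).
Proof. apply holomorphic_pcont, Hf. Qed.

Lemma qexp_coord (x t : R) :
  qexp 1 (x, t) = (qexp 1 (RtoC x) * RtoC (exp (- (2 * PI * t))))%C.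
Proof.
  replace ((x, t) : C) with (RtoC x + (0, t))%C
    by (unfold RtoC, Cplus; simpl; f_equal; ring).
  rewrite qexp_plus. f_equal. unfold qexp, Cdiv. rewrite (INC_inv 1) by lia.
  unfold Cexp; simpl. rewrite Rinv_1.
  match goal with |- (exp ?p * cos ?q, _) = _ => replace p with (- (2 * PI * t)) by ring;
    replace q with 0 by ring end.
  rewrite cos_0, sin_0. unfold RtoC. f_equal; ring.
Qed.

Lemma qexp_pcont (x : R) : pcont (fun t => qexp 1 (x, t)).
Proof.
  intros t _.
  assert (H : Ccont (fun t => qexp 1 (RtoC x) * RtoC (exp (- (2 * PI * t))))%C t).
  { apply Ccont_mult; [apply Ccont_const|]. apply Ccont_RtoC.
    apply (ex_derive_continuous (K := R_AbsRing) (V := R_NormedModule)). auto_derive. trivial. }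
  destruct H as [H1 H2]. split.
  - apply (continuous_ext _ _ _ (fun s => f_equal Re (eq_sym (qexp_coord x s)))). exact H1.
  - apply (continuous_ext _ _ _ (fun s => f_equal Im (eq_sym (qexp_coord x s)))). exact H2.
Qed.

(** The full integral for [s = 2 pi n] is [W / n^(2l-1)], so [sum_coefficient_bound] applies; its
    term [n = 1] equals 1 and is subtracted from [1983/1000]. *)
Lemma sum_gamma_le (e r : R) (m : nat) :
  (1 <= m)%nat -> 0 < e <= r ->
  sum_n_m (fun n => b n * (gamma_primitive (2 * PI * INR n) w r
                           - gamma_primitive (2 * PI * INR n) w e)) 2 m <= 983 / 1000 * W.
Proof.
  intros Hm He. assert (HPI := PI_RGT_0).
  assert (HW := gamma_2pi_pos w). fold W in HW.
  apply Rle_trans with (sum_n_m (fun n => mult (K := R_Ring) W (b n / INR n ^ (2 * l - 1))) 2 m).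
  - apply Rsum_2_le. intros n Hn.
    assert (Hn0 : 0 < INR n) by (apply lt_0_INR; lia).
    assert (Hb : 0 <= b n) by (apply Rmult_le_pos; [apply pow_le; lra|apply sigma_ge_0]).
    eapply Rle_trans.
    { apply Rmult_le_compat_l; [exact Hb|]. apply incomplete_gamma_le; [|lra].
      apply Rmult_lt_0_compat; lra. }
    apply Req_le. unfold W, gamma_2pi, mult; simpl mult.
    replace (2 * l - 1)%nat with (S w) by (unfold w; lia).
    rewrite Rpow_mult_distr. unfold mult. cbn -[pow fact INR]. field.
    split; apply pow_nonzero; lra.
  - rewrite (sum_n_m_mult_l (K := R_Ring)). unfold mult. cbn -[sum_n_m pow].
    rewrite Rmult_comm. apply Rmult_le_compat_r; [lra|].
    assert (H := sum_coefficient_bound l m Hl).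
    rewrite (sum_n_m_Chasles _ 1 1 m) in H by lia. rewrite sum_n_n in H.
    rewrite sigma_1 in H. simpl INR in H. rewrite !pow1 in H.
    match type of H with plus ?p ?q <= _ => change (p + q <= 1983 / 1000) in H end.
    replace (1 * 1 / 1) with 1 in H by field.
    apply (Rplus_le_reg_l 1). replace (1 + 983 / 1000) with (1983 / 1000) by field. exact H.
Qed.

(** Cut the Fourier series after order [m]. For [u >= e], [2 pi (u - e/2) >= pi e], so the tail is
    geometric uniformly on [[e, r]], with [B] independent of [m]. *)
Lemma remainder_pointwise (x e r : R) :
  0 < e <= r -> exists B, 0 <= B /\ forall m u, (1 <= m)%nat -> e <= u <= r ->
    Cmod (f (x, u) - qexp 1 (x, u)) * u ^ w <=
      sum_n_m (fun n => b n * gamma_density (2 * PI * INR n) w u) 2 m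
      + B * exp (- (PI * e)) ^ S m.
Proof.
  intros He. assert (HPI := PI_RGT_0).
  destruct (fourier_tail 1 f a e ltac:(lia) ltac:(lra) Ha) as [B [HB HBt]].
  assert (Hr : 0 <= r ^ w) by (apply pow_le; lra).
  exists (B * r ^ w). split; [now apply Rmult_le_pos|]. intros m u Hm Hu.
  assert (Huw : 0 <= u ^ w <= r ^ w) by (split; [apply pow_le|apply pow_incr]; lra).
  assert (H := HBt m (x, u) (proj1 Hu)). simpl Im in H.
  assert (Hrho : exp (- (2 * PI * (u - e / 2) / INR 1)) ^ S m <= exp (- (PI * e)) ^ S m).
  { apply pow_incr. split; [left; apply exp_pos|]. apply exp_monotone. simpl.
    assert (PI * e <= PI * u) by (apply Rmult_le_compat_l; lra). lra. }
  set (q := qexp 1 (x, u)) in *.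
  assert (E : sum_n (G := C_AbelianMonoid) (fun n => a n * q ^ n)%C m =
              (q + sum_n_m (G := C_AbelianMonoid) (fun n => a n * q ^ n)%C 2 m)%C).
  { unfold sum_n. rewrite (sum_n_m_Chasles _ 0 1 m) by lia.
    rewrite (sum_n_Sm _ 0 0), sum_n_n by lia.
    rewrite (fourier_coeff_0 N l f a HN ltac:(lia) Hf Ha), Ha1.
    match goal with |- plus (plus ?p ?s) ?t = _ => change (((p + s) + t)%C = (q + t)%C) end.
    rewrite Cpow_1_r. Cring. }
  rewrite E in H.
  assert (Hd : Cmod (f (x, u) - q) <=
     sum_n_m (fun n => b n * exp (- (2 * PI * INR n * u))) 2 m + B * exp (- (PI * e)) ^ S m).
  { set (T := sum_n_m (G := C_AbelianMonoid) (fun n => a n * q ^ n)%C 2 m) in *.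
    replace (f (x, u) - q)%C with (T + (f (x, u) - (q + T)))%C by Cring.
    eapply Rle_trans; [apply Cmod_triangle|]. apply Rplus_le_compat.
    - eapply Rle_trans; [apply Cmod_sum_n_m|]. apply Rsum_2_le. intros n Hn.
      rewrite Cmod_mult, Cmod_pow. unfold q. rewrite Cmod_qexp_1, exp_mult_nat. simpl Im.
      apply Rmult_le_compat; [apply Cmod_ge_0|left; apply exp_pos| |].
      + apply (coefficient_bound N l f a HN ltac:(lia) Hf Ha Ha1 Heig). lia.
      + apply Req_le. f_equal. ring.
    - eapply Rle_trans; [exact H|]. now apply Rmult_le_compat_l. }
  apply (Rmult_le_compat_r (u ^ w)) in Hd; [|lra].
  eapply Rle_trans; [exact Hd|]. rewrite Rmult_plus_distr_r. apply Rplus_le_compat.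
  - apply Req_le. rewrite Rmult_comm.
    match goal with |- ?c * sum_n_m ?v 2 m = _ =>
      change (mult (K := R_Ring) c (sum_n_m (G := R_Ring) v 2 m) = sum_n_m (fun n => b n *
          gamma_density (2 * PI * INR n) w u) 2 m) end.
    rewrite <- (sum_n_m_mult_l (K := R_Ring)). apply sum_n_m_ext. intros n.
    unfold mult, gamma_density. simpl. ring.
  - rewrite Rmult_assoc, (Rmult_comm (_ ^ S m)), <- Rmult_assoc.
    apply Rmult_le_compat_r; [apply pow_le; left; apply exp_pos|].
    apply Rmult_le_compat_l; lra.
Qed.

Lemma remainder_continuous (x t : R) :
  0 < t -> continuous (fun u => Cmod (f (x, u) - qexp 1 (x, u)) * u ^ w) t.
Proof.
  intros Ht. apply (continuous_mult (K := R_AbsRing) (fun u => Cmod (f (x, u) - qexp 1 (x, u)))).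
  - apply continuous_Cmod, Ccont_minus; [now apply form_pcont|now apply qexp_pcont].
  - apply (ex_derive_continuous (K := R_AbsRing) (V := R_NormedModule)). auto_derive. trivial.
Qed.

Lemma remainder_moment (x e r : R) :
  0 < e <= r ->
  RInt (fun u => Cmod (f (x, u) - qexp 1 (x, u)) * u ^ w) e r <= 983 / 1000 * W.
Proof.
  intros He. assert (HPI := PI_RGT_0).
  destruct (remainder_pointwise x e r He) as [B [HB H]].
  assert (HI := pos_is_RInt _ e r (remainder_continuous x) ltac:(lra) ltac:(lra)).
  set (I := RInt _ e r) in *.
  set (rho := exp (- (PI * e))) in *.
  assert (Hrho : 0 < rho < 1).
  { split; [apply exp_pos|]. unfold rho. rewrite <- exp_0. apply exp_increasing.
    assert (0 < PI * e) by (apply Rmult_lt_0_compat; lra). lra. }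
  apply le_epsilon. intros eps Heps.
  (* The integrated tail is [(r - e) B rho^(m+2)], at most [eps] for [m] large, while the bound on
     the finite sum does not depend on [m]. The [+ 1] keeps [D] positive. *)
  set (D := (r - e) * B + 1).
  assert (HD : 0 <= (r - e) * B) by (apply Rmult_le_pos; lra).
  destruct (pow_lt_1_zero rho ltac:(rewrite Rabs_right; lra) (eps / D)) as [m Hm].
  { apply Rdiv_lt_0_compat; unfold D; lra. }
  assert (H1 := Hm (S (S m)) ltac:(lia)). rewrite Rabs_right in H1 by (apply Rle_ge, pow_le; lra).
  set (k := B * rho ^ S (S m)) in *.
  assert (HS := is_RInt_sum_gamma b (fun n => 2 * PI * INR n) w (S m) e r).
  specialize (HS ltac:(intros n Hn; apply Rmult_lt_0_compat; [lra|apply lt_0_INR; lia])).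
  assert (HK := is_RInt_const (V := R_NormedModule) e r k).
  assert (HSK := is_RInt_plus (V := R_NormedModule) _ _ _ _ _ _ HS HK).
  assert (HG := sum_gamma_le e r (S m) ltac:(lia) He).
  assert (Hle := is_RInt_le _ _ e r _ _ ltac:(lra) HI HSK
                   ltac:(intros u Hu; apply (H (S m) u); [lia|lra])).
  eapply Rle_trans; [exact Hle|].
  apply Rplus_le_compat; [exact HG|].
  change ((r - e) * k <= eps). unfold k.
  apply Rle_trans with (D * (eps / D)); [|apply Req_le; field; unfold D; lra].
  rewrite <- Rmult_assoc. apply Rmult_le_compat; [exact HD|apply pow_le; lra|unfold D; lra|lra].
Qed.

Lemma absolute_moment (x e r : R) :
  0 < e <= r -> RInt (fun u => Cmod (f (x, u)) * u ^ w) e r <= 2 * W.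
Proof.
  intros He. assert (HPI := PI_RGT_0).
  assert (HW := gamma_2pi_pos w). fold W in HW.
  assert (HR := remainder_moment x e r He).
  assert (HI := pos_is_RInt _ e r (remainder_continuous x) ltac:(lra) ltac:(lra)).
  assert (HG := is_RInt_gamma (2 * PI) w e r ltac:(lra)).
  assert (HGle := incomplete_gamma_le (2 * PI) w e r ltac:(lra) ltac:(lra)).
  fold (gamma_2pi w) in HGle. fold W in HGle.
  assert (HF : is_RInt (fun u => Cmod (f (x, u)) * u ^ w) e r (RInt (fun u => Cmod (f (x, u)) *
      u ^ w) e r)).
  { apply pos_is_RInt; try lra. intros t Ht.
    apply (continuous_mult (K := R_AbsRing) (fun u => Cmod (f (x, u)))).
    - now apply continuous_Cmod, form_pcont.
    - apply (ex_derive_continuous (K := R_AbsRing) (V := R_NormedModule)). auto_derive. trivial. }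
  assert (H := is_RInt_le _ _ e r _ _ ltac:(lra) HF (is_RInt_plus (V := R_NormedModule) _ _ _ _
      _ _ HI HG)).
  eapply Rle_trans; [apply H|].
  - intros u Hu. unfold gamma_density.
    change (Cmod (f (x, u)) * u ^ w <= Cmod (f (x, u) - qexp 1 (x, u)) * u ^ w + exp (- (2 * PI
        * u)) * u ^ w).
    rewrite <- Rmult_plus_distr_r. apply Rmult_le_compat_r; [apply pow_le; lra|].
    replace (exp (- (2 * PI * u))) with (Cmod (qexp 1 (x, u))) by (now rewrite Cmod_qexp_1).
    eapply Rle_trans; [|apply Cmod_triangle]. apply Req_le. f_equal. ring.
  - apply Rle_trans with (983 / 1000 * W + W); [|lra].
    exact (Rplus_le_compat _ _ _ _ HR HGle).
Qed.

(** The moment of [q] is a number of modulus 1 times a truncated gamma integral of size at least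
    [W - eta]; subtract the remainder [0.983 W]. That [delta] does not depend on [x] permits any
    line, in particular the one above [- d / c]. *)
Lemma moment_lower_bound (eta : R) :
  0 < eta -> exists delta, 0 < delta /\ forall x e r, 0 < e <= delta -> / delta <= r -> e <= r ->
    17 / 1000 * W - eta <= Cmod (CInt (fun u => f (x, u) * RtoC (u ^ w))%C e r).
Proof.
  intros Heta. assert (HPI := PI_RGT_0).
  destruct (incomplete_gamma_limit (2 * PI) w eta ltac:(lra) Heta) as [delta [Hd Hlim]].
  exists delta. split; [exact Hd|]. intros x e r He Hr Her.
  assert (HJ := Hlim e r ltac:(lra) Hr). fold (gamma_2pi w) in HJ. fold W in HJ.
  set (J := gamma_primitive (2 * PI) w r - gamma_primitive (2 * PI) w e) in *.
  assert (HG : is_CInt (fun u => qexp 1 (RtoC x) * RtoC (gamma_density (2 * PI) w u))%C e r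
                 (qexp 1 (RtoC x) * RtoC J)%C).
  { apply is_CInt_Cmult, is_CInt_RtoC, is_RInt_gamma. lra. }
  assert (Hpw : pcont (fun u => RtoC (u ^ w))).
  { intros t Ht. apply Ccont_RtoC.
    apply (ex_derive_continuous (K := R_AbsRing) (V := R_NormedModule)). auto_derive. trivial. }
  assert (HF : is_CInt (fun u => f (x, u) * RtoC (u ^ w))%C e r
                 (CInt (fun u => f (x, u) * RtoC (u ^ w))%C e r)).
  { apply pcont_is_CInt; try lra. intros t Ht.
    apply Ccont_mult; [now apply form_pcont|now apply Hpw]. }
  set (I := CInt _ e r) in *.
  assert (HD := is_CInt_minus _ _ _ _ _ _ HG HF).
  assert (HI := pos_is_RInt _ e r (remainder_continuous x) ltac:(lra) ltac:(lra)).
  assert (Hle := fun H => Cmod_CInt_le _ _ e r _ _ Her H HD HI).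
  assert (HR := remainder_moment x e r ltac:(lra)).
  assert (Hq : Cmod (qexp 1 (RtoC x) * RtoC J)%C >= J).
  { rewrite Cmod_mult, Cmod_qexp_1, Cmod_R. simpl Im.
    rewrite Rmult_0_r, Ropp_0, exp_0, Rmult_1_l. apply Rle_ge, Rle_abs. }
  assert (Htri : Cmod (qexp 1 (RtoC x) * RtoC J)%C <= Cmod (qexp 1 (RtoC x) * RtoC J - I)%C +
      Cmod I).
  { eapply Rle_trans; [|apply Cmod_triangle]. apply Req_le. f_equal. Cring. }
  assert (Hle' : Cmod (qexp 1 (RtoC x) * RtoC J - I)%C <= 983 / 1000 * W).
  { eapply Rle_trans; [apply Hle|exact HR]. intros u Hu. apply Req_le.
    rewrite qexp_coord. unfold gamma_density.
    transitivity (Cmod ((f (x, u) - qexp 1 (RtoC x) * RtoC (exp (- (2 * PI * u)))) * RtoC (u ^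
        w))%C).
    - rewrite <- Cmod_opp. f_equal. rewrite RtoC_mult. ring.
    - rewrite Cmod_mult, Cmod_R, Rabs_right by (apply Rle_ge, pow_le; lra). reflexivity. }
  lra.
Qed.

(** * Transport of the moments to the cusp [a / c] *)

Section Cusp.
Context (p q c d : Z) (Hg : Gamma0 N (Mat2 p q c d)) (Hc : (0 < c)%Z).

Let x := IZR p / IZR c.
Let x' := - IZR d / IZR c.

Lemma IZR_c_pos : 0 < IZR c.
Proof. now apply IZR_lt. Qed.

(** The real number [x'] is the preimage of infinity under the matrix, so on the line above it the
    automorphy factor is the pure imaginary [i c u], and the matrix maps this line onto the one
    above [x], upside down. *)
Lemma cusp_transformation (u : R) :
  0 < u -> f (x, / (IZR c ^ 2 * u)) = ((0, (IZR c * u)%R)%R ^ (2 * l) * f (x', u))%C.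
Proof.
  intros Hu. assert (Hc0 := IZR_c_pos).
  destruct Hf as [_ [Hinv _]]. assert (H := Hinv _ (x', u) Hg Hu).
  assert (Haut : automorphy (Mat2 p q c d) (x', u) = (0, IZR c * u)).
  { rewrite automorphy_coord. simpl. unfold x'. f_equal. field. lra. }
  assert (Hnz : ((0, IZR c * u) : C) <> 0).
  { intros E. injection E as E. assert (0 < IZR c * u) by (now apply Rmult_lt_0_compat). lra. }
  assert (Hm : moebius (Mat2 p q c d) (x', u) = (x, / (IZR c ^ 2 * u))).
  { unfold moebius. rewrite Haut. simpl ma. simpl mb.
    assert (Hdet := SL2Z_IZR _ (proj1 Hg)). simpl in Hdet.
    assert (Hq : IZR q = (IZR p * IZR d - 1) / IZR c) by (field_simplify_eq; lra).
    unfold IZC. rewrite Hq. unfold x', x, RtoC, Cdiv, Cinv, Cmult, Cplus; simpl.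
    f_equal; field; lra. }
  unfold slash in H. rewrite Hm, Haut in H. rewrite <- H. field. now apply Cpow_nz.
Qed.

Lemma Cmod_imaginary (y : R) : 0 <= y -> Cmod (0, y) = y.
Proof.
  intros Hy. unfold Cmod; simpl. replace (0 * (0 * 1) + y * (y * 1)) with (y²) by (unfold Rsqr;
    ring).
  now apply sqrt_Rsqr.
Qed.

(** The Jacobian removes two powers from the weight: the plain integral above [x] becomes [c^w]
    times the moment of order [w = 2 l - 2] above [x']. *)
Lemma jacobian_identity (u : R) :
  0 < u -> / (IZR c ^ 2 * u ^ 2) * (IZR c * u) ^ (2 * l) = IZR c ^ w * u ^ w.
Proof.
  intros Hu. assert (Hc0 := IZR_c_pos). replace (2 * l)%nat with (2 + w)%nat by (unfold w; lia).
  rewrite pow_add, !Rpow_mult_distr. field. lra.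
Qed.

Lemma inversion_involutive (e : R) : 0 < e -> / (IZR c ^ 2 * / (IZR c ^ 2 * e)) = e.
Proof. intros He. assert (Hc0 := IZR_c_pos). field. lra. Qed.

Lemma inversion_pos (e : R) : 0 < e -> 0 < / (IZR c ^ 2 * e).
Proof.
  intros He. assert (Hc0 := IZR_c_pos).
  apply Rinv_0_lt_compat, Rmult_lt_0_compat; [now apply pow_lt|exact He].
Qed.

Lemma inversion_antitone (e r : R) : 0 < e <= r -> / (IZR c ^ 2 * r) <= / (IZR c ^ 2 * e).
Proof.
  intros He. assert (Hc0 := IZR_c_pos). assert (0 < IZR c ^ 2) by now apply pow_lt.
  apply Rinv_le_contravar; [apply Rmult_lt_0_compat; lra|]. apply Rmult_le_compat_l; lra.
Qed.

Lemma cusp_absolute_integral (e r : R) :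
  0 < e <= r -> RInt (fun t => Cmod (f (x, t))) e r <= 2 * W * IZR c ^ w.
Proof.
  intros He. assert (Hc0 := IZR_c_pos).
  set (e' := / (IZR c ^ 2 * r)). set (r' := / (IZR c ^ 2 * e)).
  assert (He' : 0 < e') by (apply inversion_pos; lra).
  assert (Her' : e' <= r') by (apply inversion_antitone; lra).
  assert (H := RInt_inversion R_CompleteNormedModule (fun t => Cmod (f (x, t))) (IZR c) e' r'
           Hc0 He' ltac:(lra) ltac:(intros t Ht; now apply continuous_Cmod, form_pcont)).
  unfold e' at 2, r' at 2 in H. rewrite !inversion_involutive in H by lra.
  assert (HM := absolute_moment x' e' r' ltac:(lra)).
  assert (HF : is_RInt (fun u => Cmod (f (x', u)) * u ^ w) e' r' (RInt (fun u => Cmod (f (x',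
      u)) * u ^ w) e' r')).
  { apply pos_is_RInt; try lra. intros t Ht.
    apply (continuous_mult (K := R_AbsRing) (fun u => Cmod (f (x', u)))).
    - now apply continuous_Cmod, form_pcont.
    - apply (ex_derive_continuous (K := R_AbsRing) (V := R_NormedModule)). auto_derive. trivial. }
  apply (is_RInt_scal (V := R_NormedModule) _ _ _ (IZR c ^ w)) in HF.
  assert (E : is_RInt (fun u => scal (IZR c ^ w) (Cmod (f (x', u)) * u ^ w)) e' r'
                (RInt (fun t => Cmod (f (x, t))) e r)).
  { eapply is_RInt_ext; [|exact H]. intros u Hu. rewrite Rmin_left in Hu by exact Her'.
    simpl. unfold scal; simpl; unfold mult; simpl.
    change (/ (IZR c ^ 2 * u ^ 2) * Cmod (f (x, / (IZR c ^ 2 * u))) = IZR c ^ w * (Cmod (f (x',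
        u)) * u ^ w)).
    rewrite cusp_transformation by lra. rewrite Cmod_mult, Cmod_pow, Cmod_imaginary.
    - rewrite <- Rmult_assoc, jacobian_identity by lra. ring.
    - apply Rmult_le_pos; lra. }
  rewrite (eq_trans (eq_sym (is_RInt_unique (V := R_CompleteNormedModule) _ _ _ _ E))
             (is_RInt_unique (V := R_CompleteNormedModule) _ _ _ _ HF)).
  unfold scal; simpl; unfold mult; simpl. rewrite Rmult_comm.
  apply Rmult_le_compat_r; [apply pow_le; lra|exact HM].
Qed.

Lemma scal_C_R (s : R) (z : C) : scal (V := C_R_NormedModule) s z = (RtoC s * z)%C.
Proof.
  destruct z as [y t]. unfold RtoC, Cmult; simpl.
  change ((s * y, s * t) = (s * y - 0 * t, s * t + 0 * y)). f_equal; ring.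
Qed.

Lemma Ci_pow_norm (n : nat) : Cmod (Ci ^ n) = 1.
Proof. rewrite Cmod_pow, Cmod_Ci. apply pow1. Qed.

Lemma cusp_integral_lower_bound (eta : R) :
  0 < eta -> exists delta, 0 < delta /\ forall e r, 0 < e <= delta -> / delta <= r -> e <= r ->
    (17 / 1000 * W - eta) * IZR c ^ w <= Cmod (CInt (fun t => f (x, t)) e r).
Proof.
  intros Heta. assert (Hc0 := IZR_c_pos). assert (Hc2 : 0 < IZR c ^ 2) by now apply pow_lt.
  destruct (moment_lower_bound eta Heta) as [delta [Hd Hlow]].
  (* The inverted interval must satisfy [1 / (c^2 r) <= delta] and [1 / (c^2 e) >= 1 / delta], so
     the witness has to be at most both [c^2 delta] and [delta / c^2]. *)
  exists (Rmin delta 1 / IZR c ^ 2 * Rmin 1 (IZR c ^ 2 * IZR c ^ 2)).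
  set (m1 := Rmin delta 1). set (m2 := Rmin 1 _).
  assert (Hc4 : 0 < IZR c ^ 2 * IZR c ^ 2) by now apply Rmult_lt_0_compat.
  assert (Hm1 : 0 < m1 <= delta) by (split; [apply Rmin_glb_lt; lra|apply Rmin_l]).
  assert (Hm2 : 0 < m2 <= 1) by (split; [apply Rmin_glb_lt; lra|apply Rmin_l]).
  assert (Hm2' : m2 <= IZR c ^ 2 * IZR c ^ 2) by apply Rmin_r.
  set (d1 := m1 / IZR c ^ 2 * m2).
  assert (Hm1c : 0 < m1 / IZR c ^ 2) by (apply Rdiv_lt_0_compat; lra).
  assert (Hd1 : 0 < d1) by (apply Rmult_lt_0_compat; lra).
  assert (Hd1a : IZR c ^ 2 * d1 <= delta).
  { unfold d1. replace (IZR c ^ 2 * (m1 / IZR c ^ 2 * m2)) with (m1 * m2) by (field; lra). nra. }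
  assert (Hd1b : d1 <= IZR c ^ 2 * delta).
  { unfold d1. apply Rle_trans with (m1 / IZR c ^ 2 * (IZR c ^ 2 * IZR c ^ 2)).
    - apply Rmult_le_compat_l; lra.
    - replace (m1 / IZR c ^ 2 * (IZR c ^ 2 * IZR c ^ 2)) with (IZR c ^ 2 * m1) by (field; lra).
      apply Rmult_le_compat_l; lra. }
  split; [exact Hd1|]. intros e r He Hr Her.
  set (e' := / (IZR c ^ 2 * r)). set (r' := / (IZR c ^ 2 * e)).
  assert (Hr0 : 0 < r) by lra.
  assert (He' : 0 < e') by (apply inversion_pos; lra).
  assert (Her' : e' <= r') by (apply inversion_antitone; lra).
  assert (Hed : e' <= delta).
  { unfold e'. assert (H1 : / (IZR c ^ 2 * delta) <= / d1) by (now apply Rinv_le_contravar).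
    rewrite <- (Rinv_inv delta). apply Rinv_le_contravar; [now apply Rinv_0_lt_compat|].
    apply (Rmult_le_compat_l (IZR c ^ 2)) in H1; [|lra].
    replace (IZR c ^ 2 * / (IZR c ^ 2 * delta)) with (/ delta) in H1 by (field; lra).
    apply (Rmult_le_compat_l (IZR c ^ 2)) in Hr; lra. }
  assert (Hrd : / delta <= r').
  { unfold r'. apply Rinv_le_contravar; [apply Rmult_lt_0_compat; lra|].
    eapply Rle_trans; [|exact Hd1a]. apply Rmult_le_compat_l; lra. }
  assert (HM := Hlow x' e' r' ltac:(lra) Hrd Her').
  assert (H := RInt_inversion C_R_CompleteNormedModule (fun t => f (x, t)) (IZR c) e' r'
           Hc0 He' ltac:(lra) ltac:(intros t Ht; now apply Ccont_continuous, form_pcont)).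
  unfold e' at 2, r' at 2 in H. rewrite !inversion_involutive in H by lra.
  set (I := CInt (fun u => f (x', u) * RtoC (u ^ w))%C e' r') in *.
  assert (HF : is_CInt (fun u => f (x', u) * RtoC (u ^ w))%C e' r' I).
  { apply pcont_is_CInt; try lra. intros t Ht.
    apply Ccont_mult; [now apply form_pcont|]. apply Ccont_RtoC.
    apply (ex_derive_continuous (K := R_AbsRing) (V := R_NormedModule)). auto_derive. trivial. }
  apply (is_CInt_Cmult (Ci ^ (2 * l) * RtoC (IZR c ^ w))%C) in HF.
  assert (E : is_CInt (fun u => Ci ^ (2 * l) * RtoC (IZR c ^ w) * (f (x', u) * RtoC (u ^ w)))%C
      e' r'
                (CInt (fun t => f (x, t)) e r)).
  { eapply is_RInt_ext; [|exact H]. intros u Hu. rewrite Rmin_left in Hu by exact Her'.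
    change (scal (V := C_R_NormedModule) (/ (IZR c ^ 2 * u ^ 2)) (f (x, / (IZR c ^ 2 * u)))
            = (Ci ^ (2 * l) * RtoC (IZR c ^ w) * (f (x', u) * RtoC (u ^ w)))%C).
    rewrite cusp_transformation by lra.
    replace ((0, IZR c * u) : C) with (Ci * RtoC (IZR c * u))%C
      by (unfold Ci, RtoC, Cmult; simpl; f_equal; ring).
    rewrite scal_C_R, Cpow_mult_l, <- RtoC_pow.
    transitivity (Ci ^ (2 * l) * RtoC (/ (IZR c ^ 2 * u ^ 2) * (IZR c * u) ^ (2 * l)) * f (x',
        u))%C.
    - rewrite RtoC_mult. Cring.
    - rewrite jacobian_identity by lra. rewrite RtoC_mult. Cring. }
  rewrite (eq_trans (eq_sym (is_RInt_unique (V := C_R_CompleteNormedModule) _ _ _ _ E))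
             (is_RInt_unique (V := C_R_CompleteNormedModule) _ _ _ _ HF)).
  rewrite !Cmod_mult, Ci_pow_norm, Cmod_R, Rabs_right by (apply Rle_ge, pow_le; lra).
  rewrite Rmult_1_l, Rmult_comm. apply Rmult_le_compat_l; [apply pow_le; lra|exact HM].
Qed.

End Cusp.
End MomentBounds.

(** * Period polynomials and their zeros *)

(** Multiplication by [c] is continuous at the limit; [|c| + 1] replaces [|c|] as Lipschitz constant
    to allow [c = 0]. *)
Lemma improper_Cmult (c : C) (g : R -> C) (l : C) :
  is_CInt_improper g l -> is_CInt_improper (fun t => c * g t)%C (c * l)%C.
Proof.
  intros H P HP.
  apply (locally_norm_le_locally (V := C_R_NormedModule)) in HP.
  destruct HP as [eps Heps].
  assert (Hc := Cmod_ge_0 c).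
  assert (He : 0 < eps / (Cmod c + 1)) by (apply Rdiv_lt_0_compat; [apply cond_pos|lra]).
  assert (HP' : locally (T := C_R_NormedModule) l (fun y => P (c * y)%C)).
  { apply (locally_le_locally_norm (V := C_R_NormedModule)).
    exists (mkposreal _ He). intros y Hy. apply Heps.
    unfold ball_norm in *. rewrite norm_C_R in *. simpl in Hy.
    change (Cmod (c * y - c * l)%C < eps). change (Cmod (y - l)%C < eps / (Cmod c + 1)) in Hy.
    replace (c * y - c * l)%C with (c * (y - l))%C by ring. rewrite Cmod_mult.
    apply Rle_lt_trans with ((Cmod c + 1) * Cmod (y - l)).
    - apply Rmult_le_compat_r; [apply Cmod_ge_0|lra].
    - apply (Rmult_lt_compat_l (Cmod c + 1)) in Hy; [|lra].
      replace ((Cmod c + 1) * (eps / (Cmod c + 1))) with (pos eps) in Hy by (field; lra).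
      exact Hy. }
  specialize (H _ HP'). unfold filtermapi in *.
  revert H. apply filter_imp. intros ab [y [Hy HPy]].
  exists (c * y)%C. split; [now apply is_CInt_Cmult|exact HPy].
Qed.

Lemma pow_1_plus_le (w : nat) (t : R) : 0 <= t -> (1 + t) ^ w <= 2 ^ w * (1 + t ^ w).
Proof.
  intros Ht. assert (H2 : 0 <= 2 ^ w) by (apply pow_le; lra).
  assert (Htw := pow_le t w Ht).
  destruct (Rle_dec t 1) as [H|H].
  - apply Rle_trans with (2 ^ w); [apply pow_incr; lra|nra].
  - apply Rle_trans with ((2 * t) ^ w); [apply pow_incr; lra|].
    rewrite Rpow_mult_distr. nra.
Qed.

(** The graph of [v -> (1 + v)^w] lies below its chord from 0; this extracts the small factor
    [theta = 1 / s] in the root bound. *)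
Lemma pow_convex (w : nat) (theta v : R) :
  0 <= theta <= 1 -> 0 <= v -> (1 + theta * v) ^ w - 1 <= theta * ((1 + v) ^ w - 1).
Proof.
  intros Hth Hv. induction w as [|w IH]; [simpl; lra|].
  rewrite <- !tech_pow_Rmult.
  assert (H1 : 1 <= (1 + v) ^ w) by (apply pow_R1_Rle; lra).
  assert (H2 : 0 <= theta * v) by (apply Rmult_le_pos; lra).
  assert (H3 : theta * v <= v) by nra.
  assert (H4 : 0 <= theta * ((1 + v) ^ w - 1)) by (apply Rmult_le_pos; lra).
  apply Rle_trans with ((1 + theta * v) * (theta * ((1 + v) ^ w - 1)) + theta * v).
  - apply (Rmult_le_compat_l (1 + theta * v)) in IH; lra.
  - apply Rle_trans with ((1 + v) * (theta * ((1 + v) ^ w - 1)) + theta * v); [|apply Req_le;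
      ring].
    apply Rplus_le_compat_r, Rmult_le_compat_r; lra.
Qed.

(** By the binomial theorem [(u + v)^w - v^w] has nonnegative coefficients in [u] and [v], so its
    modulus is largest for [|u|] and [|v|]. *)
Lemma Cmod_pow_diff (w : nat) (u v : C) :
  Cmod ((u + v) ^ w - v ^ w) <= (Cmod u + Cmod v) ^ w - Cmod v ^ w.
Proof.
  induction w as [|w IH].
  - simpl. replace (1 - 1)%C with (RtoC 0) by ring. rewrite Cmod_0. lra.
  - replace ((u + v) ^ S w - v ^ S w)%C with ((u + v) * ((u + v) ^ w - v ^ w) + u * v ^ w)%C
      by (rewrite !Cpow_S; ring).
    eapply Rle_trans; [apply Cmod_triangle|]. rewrite !Cmod_mult, Cmod_pow.
    apply Rle_trans with ((Cmod u + Cmod v) * ((Cmod u + Cmod v) ^ w - Cmod v ^ w)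
                          + Cmod u * Cmod v ^ w).
    + apply Rplus_le_compat_r.
      apply Rmult_le_compat; [apply Cmod_ge_0|apply Cmod_ge_0|apply Cmod_triangle|exact IH].
    + rewrite <- !tech_pow_Rmult. apply Req_le. ring.
Qed.

(** With the weight [(1 + t)^n] one condition controls both ends, and since
    [|x + i t| <= (1 + |x|) (1 + t)], a factor [z] lowers [n] by one. *)
Definition absolutely_integrable_pow (n : nat) (h : R -> C) : Prop :=
  pcont h /\ exists B, forall a b, 0 < a <= b ->
    RInt (fun t => Cmod (h t) * (1 + t) ^ n) a b <= B.

Lemma weighted_is_RInt (n : nat) (h : R -> C) (a b : R) :
  pcont h -> 0 < a -> 0 < b ->
  is_RInt (fun t => Cmod (h t) * (1 + t) ^ n) a b (RInt (fun t => Cmod (h t) * (1 + t) ^ n) a b).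
Proof.
  intros Hh. apply pos_is_RInt. intros t Ht.
  apply (continuous_mult (K := R_AbsRing) (fun u => Cmod (h u))).
  - now apply continuous_Cmod, Hh.
  - apply (ex_derive_continuous (K := R_AbsRing) (V := R_NormedModule)). auto_derive. trivial.
Qed.

Lemma absolutely_integrable_pow_dominated (n m : nat) (g h : R -> C) (M : R) :
  absolutely_integrable_pow n g -> pcont h ->
  (forall t, 0 < t -> Cmod (h t) * (1 + t) ^ m <= M * (Cmod (g t) * (1 + t) ^ n)) -> 0 <= M ->
  absolutely_integrable_pow m h.
Proof.
  intros [Hg [B HB]] Hh Hle HM. split; [exact Hh|]. exists (M * B). intros a b Hab.
  assert (H1 := weighted_is_RInt m h a b Hh ltac:(lra) ltac:(lra)).
  assert (H2 := weighted_is_RInt n g a b Hg ltac:(lra) ltac:(lra)).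
  apply (is_RInt_scal (V := R_NormedModule) _ _ _ M) in H2.
  eapply Rle_trans; [apply (is_RInt_le _ _ a b _ _ (proj2 Hab) H1 H2)|].
  - intros t Ht. apply Hle. lra.
  - apply (Rmult_le_compat_l M); [exact HM|]. now apply HB.
Qed.

Lemma vertical_line_pcont (x : R) : pcont (fun t => (x, t)).
Proof. intros t _. split; [apply continuous_const|apply continuous_id]. Qed.

Lemma Cmod_vertical_line (x t : R) : 0 <= t -> Cmod (x, t) <= (1 + Rabs x) * (1 + t).
Proof.
  intros Ht. replace ((x, t) : C) with (RtoC x + (0%R, t))%C
    by (unfold RtoC, Cplus; simpl; f_equal; ring).
  eapply Rle_trans; [apply Cmod_triangle|]. rewrite Cmod_R, Cmod_imaginary by exact Ht.
  assert (H := Rabs_pos x). nra.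
Qed.

Lemma absolutely_integrable_pow_S (n : nat) (h : R -> C) (x : R) :
  absolutely_integrable_pow (S n) h ->
  absolutely_integrable_pow n h /\ absolutely_integrable_pow n (fun t => h t * (x, t))%C.
Proof.
  intros H. assert (Hh := proj1 H). assert (Hx := Rabs_pos x). split.
  - apply (absolutely_integrable_pow_dominated (S n) n h h 1 H Hh); [|lra]. intros t Ht.
    assert (H1 := Cmod_ge_0 (h t)). assert (H2 : 0 <= (1 + t) ^ n) by (apply pow_le; lra).
    rewrite <- tech_pow_Rmult, Rmult_1_l. apply Rmult_le_compat_l; [exact H1|]. nra.
  - apply (absolutely_integrable_pow_dominated (S n) n h _ (1 + Rabs x) H); [| |lra].
    + intros t Ht. apply Ccont_mult; [now apply Hh|now apply vertical_line_pcont].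
    + intros t Ht. rewrite Cmod_mult, <- tech_pow_Rmult.
      assert (H1 := Cmod_ge_0 (h t)). assert (H2 : 0 <= (1 + t) ^ n) by (apply pow_le; lra).
      assert (H3 := Cmod_vertical_line x t ltac:(lra)).
      apply (Rmult_le_compat_l (Cmod (h t) * (1 + t) ^ n)) in H3; [lra|now apply Rmult_le_pos].
Qed.

Lemma absolutely_integrable_convergence (h : R -> C) :
  absolutely_integrable_pow 0 h ->
  exists l, is_CInt_improper h l /\
    forall eps, 0 < eps -> exists delta, 0 < delta /\
      forall a b, 0 < a < delta -> / delta < b -> Cmod (CInt h a b - l) < eps.
Proof.
  intros [Hh [B HB]]. apply (improper_convergence h B Hh). intros a b Hab.
  eapply Rle_trans; [|apply (HB a b Hab)]. apply Req_le. apply RInt_ext.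
  intros t _. simpl. symmetry. apply Rmult_1_r.
Qed.

(* By induction on [n], from
   [(z - X)^(n+1) = z * (z - X)^n - X * (z - X)^n]. *)
Lemma improper_integral_polynomial (n : nat) (x : R) (h : R -> C) :
  absolutely_integrable_pow n h ->
  exists p : nat -> C,
    is_CInt_improper h ((-1) ^ n * p n)%C /\
    forall X, is_CInt_improper (fun t => h t * ((x, t) - X) ^ n)%C
                (sum_n (G := C_AbelianMonoid) (fun j => p j * X ^ j)%C n).
Proof.
  revert h. induction n as [|n IH]; intros h Hh.
  - destruct (absolutely_integrable_convergence h Hh) as [l [Hl _]].
    exists (fun _ => l). split.
    + replace ((-1) ^ 0 * l)%C with l by (simpl; ring). exact Hl.
    + intros X. rewrite sum_O. replace (l * X ^ 0)%C with l by (simpl; ring).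
      apply (improper_ext h); [|exact Hl]. intros t. simpl. ring.
  - destruct (absolutely_integrable_pow_S n h x Hh) as [H1 H2].
    destruct (IH _ H1) as [p [Hp Hpoly]]. destruct (IH _ H2) as [q [_ Hqpoly]].
    (* Coefficient [j] is [q j - p (j - 1)]. The test cuts [q] off at its degree [n], so the top
       coefficient is [- p n]; this carries along the identity between the leading coefficient and
       the integral of [h]. *)
    exists (fun j => match j with
                     | O => q 0%nat
                     | S i => ((if Nat.leb j n then q j else 0) - p i)%C
                     end).
    split.
    + rewrite (proj2 (Nat.leb_gt (S n) n)) by lia.
      replace ((-1) ^ S n * (0 - p n))%C with ((-1) ^ n * p n)%C by (rewrite Cpow_S; ring).
      exact Hp.
    + intros X.
      assert (E : forall m, (m <= n)%nat ->
        (sum_n (G := C_AbelianMonoid) (fun j => q j * X ^ j)%C m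
         + - X * sum_n (G := C_AbelianMonoid) (fun j => p j * X ^ j)%C m)%C =
        (sum_n (G := C_AbelianMonoid) (fun j => match j with
                     | O => q 0%nat
                     | S i => ((if Nat.leb j n then q j else 0) - p i)%C
                     end * X ^ j)%C m - p m * X ^ S m)%C).
      { induction m as [|m IHm]; intros Hm.
        - rewrite !sum_O. simpl. Cring.
        - rewrite !Csum_n_S. rewrite (proj2 (Nat.leb_le (S m) n)) by lia.
          specialize (IHm ltac:(lia)).
          match goal with |- ((?a + ?b) + - X * (?c + ?d))%C = _ =>
            transitivity ((a + - X * c) + (b + - X * d))%C; [Cring|] end.
          rewrite IHm. rewrite !Cpow_S. Cring. }
      rewrite Csum_n_S. rewrite (proj2 (Nat.leb_gt (S n) n)) by lia.
      assert (E' := E n (le_n n)).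
      match goal with |- is_CInt_improper _ (?s + ?u)%C =>
        replace (s + u)%C with (sum_n (G := C_AbelianMonoid) (fun j => q j * X ^ j)%C n
         + - X * sum_n (G := C_AbelianMonoid) (fun j => p j * X ^ j)%C n)%C
          by (rewrite E'; Cring) end.
      apply (improper_ext (fun t => h t * (x, t) * ((x, t) - X) ^ n
                                    + - X * (h t * ((x, t) - X) ^ n))%C).
      * intros t. rewrite Cpow_S. ring.
      * apply improper_plus; [apply Hqpoly|apply improper_Cmult, Hpoly].
Qed.

(** * The leading coefficient and the location of the zeros *)

Section RootBound.
Context (N l : nat) (f : C -> C) (a : nat -> C).
Context (HN : (1 <= N)%nat) (Hl : (3 <= l)%nat) (Hf : cusp_form N (2 * l) f).
Context (Ha : fourier_expansion 1 f a) (Ha1 : a 1%nat = 1).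
Context (Heig : hecke_eigenform N (2 * l) f).
Context (p q c d : Z) (Hg : Gamma0 N (Mat2 p q c d)) (Hc : (0 < c)%Z).

Let w := (2 * l - 2)%nat.
Let W := gamma_2pi w.
Let x := IZR p / IZR c.
Let h (t : R) : C := (f (x, t) * Ci)%C.

Lemma Cmod_h (t : R) : Cmod (h t) = Cmod (f (x, t)).
Proof. unfold h. rewrite Cmod_mult, Cmod_Ci. apply Rmult_1_r. Qed.

Lemma h_pcont : pcont h.
Proof.
  intros t Ht. apply Ccont_mult; [now apply (form_pcont N l f Hf)|apply Ccont_const].
Qed.

(* [s = c] gives the scaling of the root bound, [s = 1] the convergence of the
   period integrals. *)
Lemma scaled_integral_bound (s e r : R) :
  0 <= s -> 0 < e <= r ->
  is_RInt (fun t => Cmod (h t) * (1 + (s * t) ^ w)) e r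
    (RInt (fun t => Cmod (h t) * (1 + (s * t) ^ w)) e r) /\
  RInt (fun t => Cmod (h t) * (1 + (s * t) ^ w)) e r <= 2 * W * (IZR c ^ w + s ^ w).
Proof.
  intros Hs He. assert (Hsw := pow_le s w Hs).
  assert (HI : is_RInt (fun t => Cmod (h t) * (1 + (s * t) ^ w)) e r
             (RInt (fun t => Cmod (h t) * (1 + (s * t) ^ w)) e r)).
  { apply pos_is_RInt; try lra. intros t Ht.
    apply (continuous_mult (K := R_AbsRing) (fun u => Cmod (h u))).
    - now apply continuous_Cmod, h_pcont.
    - apply (ex_derive_continuous (K := R_AbsRing) (V := R_NormedModule)). auto_derive. trivial. }
  split; [exact HI|].
  assert (H0 : is_RInt (fun t => Cmod (f (x, t))) e r (RInt (fun t => Cmod (f (x, t))) e r)).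
  { apply pcont_is_RInt_Cmod; try lra. now apply (form_pcont N l f Hf). }
  assert (Hw : is_RInt (fun t => Cmod (f (x, t)) * t ^ w) e r (RInt (fun t => Cmod (f (x, t)) *
      t ^ w) e r)).
  { apply pos_is_RInt; try lra. intros t Ht.
    apply (continuous_mult (K := R_AbsRing) (fun u => Cmod (f (x, u)))).
    - now apply continuous_Cmod, (form_pcont N l f Hf).
    - apply (ex_derive_continuous (K := R_AbsRing) (V := R_NormedModule)). auto_derive. trivial. }
  assert (B0 := cusp_absolute_integral N l f a HN Hl Hf Ha Ha1 Heig p q c d Hg Hc e r He).
  assert (Bw := absolute_moment N l f a HN Hl Hf Ha Ha1 Heig x e r He).
  fold w in B0, Bw. fold W in B0, Bw. fold x in B0.
  assert (HS := is_RInt_plus (V := R_NormedModule) _ _ _ _ _ _ H0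
                  (is_RInt_scal (V := R_NormedModule) _ _ _ (s ^ w) _ Hw)).
  eapply Rle_trans; [apply (is_RInt_le _ _ e r _ _ (proj2 He) HI HS)|].
  - intros t Ht.
    change (Cmod (h t) * (1 + (s * t) ^ w) <= Cmod (f (x, t)) + s ^ w * (Cmod (f (x, t)) * t ^
        w)).
    rewrite Cmod_h, Rpow_mult_distr. apply Req_le. ring.
  - match goal with |- plus ?u (scal ?v ?z) <= _ => change (u + v * z <= 2 * W * (IZR c ^ w + s
        ^ w)) end.
    apply Rle_trans with (2 * W * IZR c ^ w + s ^ w * (2 * W)); [|apply Req_le; ring].
    apply Rplus_le_compat; [exact B0|]. now apply Rmult_le_compat_l.
Qed.

Lemma h_integrable : absolutely_integrable_pow w h.
Proof.
  split; [exact h_pcont|]. exists (2 ^ w * (2 * W * (IZR c ^ w + 1 ^ w))). intros e r He.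
  destruct (scaled_integral_bound 1 e r ltac:(lra) He) as [H1 H2].
  assert (H := weighted_is_RInt w h e r h_pcont ltac:(lra) ltac:(lra)).
  apply (is_RInt_scal (V := R_NormedModule) _ _ _ (2 ^ w)) in H1.
  eapply Rle_trans; [apply (is_RInt_le _ _ e r _ _ (proj2 He) H H1)|].
  - intros t Ht.
    change (Cmod (h t) * (1 + t) ^ w <= 2 ^ w * (Cmod (h t) * (1 + (1 * t) ^ w))).
    rewrite Rmult_1_l. assert (A := pow_1_plus_le w t ltac:(lra)).
    apply (Rmult_le_compat_l (Cmod (h t))) in A; [|apply Cmod_ge_0]. lra.
  - apply (Rmult_le_compat_l (2 ^ w)); [apply pow_le; lra|exact H2].
Qed.

Lemma h_integral_lower_bound (eta : R) :
  0 < eta -> exists delta, 0 < delta /\ forall e r, 0 < e <= delta -> / delta <= r -> e <= r ->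
    (17 / 1000 * W - eta) * IZR c ^ w <= Cmod (CInt h e r).
Proof.
  intros Heta.
  destruct (cusp_integral_lower_bound N l f a HN Hl Hf Ha Ha1 Heig p q c d Hg Hc eta Heta)
    as [delta [Hd H]].
  exists delta. split; [exact Hd|]. intros e r He Hr Her.
  eapply Rle_trans; [apply (H e r He Hr Her)|].
  fold x. assert (HI : is_CInt (fun t => f (x, t)) e r (CInt (fun t => f (x, t)) e r)).
  { apply pcont_is_CInt; try lra. now apply (form_pcont N l f Hf). }
  apply (is_CInt_Cmult Ci) in HI.
  apply (is_RInt_ext (V := C_R_NormedModule) _ h) in HI; [|intros t _; unfold h; Cring].
  rewrite (is_RInt_unique (V := C_R_CompleteNormedModule) _ _ _ _ HI).
  rewrite Cmod_mult, Cmod_Ci, Rmult_1_l. apply Rle_refl.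
Qed.

Lemma W_c_pos : 0 < W * IZR c ^ w.
Proof.
  assert (HW := gamma_2pi_pos w). fold W in HW.
  assert (Hc0 : 0 < IZR c) by now apply IZR_lt.
  apply Rmult_lt_0_compat; [exact HW|now apply pow_lt].
Qed.

Lemma common_interval (d1 d2 : R) :
  0 < d1 -> 0 < d2 -> exists e r, 0 < e <= r /\
    (0 < e < d1 /\ / d1 < r) /\ (0 < e <= d2 /\ / d2 <= r).
Proof.
  intros H1 H2. set (m := Rmin (Rmin d1 d2) 1).
  assert (Hm : 0 < m) by (repeat apply Rmin_glb_lt; lra).
  assert (M1 : m <= d1) by (eapply Rle_trans; apply Rmin_l).
  assert (M2 : m <= d2) by (eapply Rle_trans; [apply Rmin_l|apply Rmin_r]).
  assert (M3 : m <= 1) by apply Rmin_r.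
  exists (m / 2), (/ (m / 2)).
  assert (E1 : / d1 < / (m / 2)) by (apply Rinv_lt_contravar; [apply Rmult_lt_0_compat|]; lra).
  assert (E2 : / d2 <= / (m / 2)) by (apply Rinv_le_contravar; lra).
  assert (E3 : / 1 <= / (m / 2)) by (apply Rinv_le_contravar; lra).
  rewrite Rinv_1 in E3. repeat split; lra.
Qed.

(** If the limit were 0, truncated integrals would drop below [W c^w / 1000], yet they end up at
    least [16 W c^w / 1000]. *)
Lemma h_integral_neq_0 (L : C) : is_CInt_improper h L -> L <> 0.
Proof.
  intros HL E. assert (HWc := W_c_pos).
  assert (HW := gamma_2pi_pos w). fold W in HW.
  assert (H0 : absolutely_integrable_pow 0 h).
  { apply (absolutely_integrable_pow_dominated w 0 h h 1 h_integrable h_pcont); [|lra].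
    intros t Ht. rewrite Rmult_1_l. apply Rmult_le_compat_l; [apply Cmod_ge_0|].
    simpl. apply pow_R1_Rle. lra. }
  destruct (absolutely_integrable_convergence h H0) as [L' [HL' Hlim]].
  assert (EL : L' = L) by (rewrite <- (improper_unique _ _ HL'); exact (improper_unique _ _ HL)).
  subst L' L.
  destruct (Hlim (W * IZR c ^ w / 1000)) as [d1 [Hd1 Hlim1]]; [lra|].
  destruct (h_integral_lower_bound (W / 1000) ltac:(lra)) as [d2 [Hd2 Hlow]].
  destruct (common_interval d1 d2 Hd1 Hd2) as [e [r [Her [[He1 Hr1] [He2 Hr2]]]]].
  assert (A := Hlim1 e r He1 Hr1). assert (A' := Hlow e r He2 Hr2 (proj2 Her)).
  assert (A'' : Cmod (CInt h e r) < W * IZR c ^ w / 1000).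
  { eapply Rle_lt_trans; [|exact A]. apply Req_le. f_equal. symmetry. Cring. }
  lra.
Qed.

(* If [|X - x| >= s / c] with [s = 250 * 2^w], then [(z - X)^w] is close enough
   to the constant [(x - X)^w] on the line [Re z = x] for the integral of
   [h t * (z - X)^w] to inherit the lower bound of the integral of [h]. *)
Lemma no_distant_zero (X : C) :
  is_CInt_improper (fun t => h t * ((x, t) - X) ^ w)%C 0 ->
  Cmod (X - RtoC x) < 250 * 2 ^ w / IZR c.
Proof.
  intros HX. assert (HWc := W_c_pos).
  assert (HW := gamma_2pi_pos w). fold W in HW.
  assert (Hc0 : 0 < IZR c) by now apply IZR_lt.
  apply Rnot_le_lt. intros Hfar.
  set (s := 250 * 2 ^ w) in *. set (y := Cmod (X - RtoC x)) in *.
  assert (H2w : 1 <= 2 ^ w) by (apply pow_R1_Rle; lra).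
  assert (Hs : 1 <= s) by (unfold s; lra).
  assert (Hy : 0 < y) by (eapply Rlt_le_trans; [|exact Hfar]; apply Rdiv_lt_0_compat; lra).
  assert (Hyw : 0 < y ^ w) by now apply pow_lt.
  set (v := (RtoC x - X)%C).
  assert (Hv : Cmod v = y) by (unfold y, v; rewrite <- Cmod_opp; f_equal; ring).
  set (F := fun t => (h t * ((x, t) - X) ^ w)%C) in *.
  assert (HFp : pcont F).
  { intros t Ht. apply Ccont_mult; [now apply h_pcont|]. apply Ccont_pow, Ccont_minus.
    - now apply vertical_line_pcont.
    - apply Ccont_const. }
  (* With [z - X = i t + v] and [|v| = y], the difference of powers is at most
     [y^w ((1 + t/y)^w - 1)]. As [t / y <= c t / s], convexity bounds the bracket by
     [((1 + c t)^w - 1) / s], and the factor [2^w] in [s] absorbs the one from [pow_1_plus_le]. *)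
  assert (Hdiff : forall t, 0 < t ->
     Cmod (F t - v ^ w * h t) <= y ^ w * / 250 * (Cmod (h t) * (1 + (IZR c * t) ^ w))).
  { intros t Ht. unfold F.
    replace ((x, t) - X)%C with ((0%R, t) + v)%C
      by (unfold v, RtoC, Cminus, Cplus, Copp; destruct X; simpl; f_equal; ring).
    replace (h t * ((0%R, t) + v) ^ w - v ^ w * h t)%C
      with (h t * (((0%R, t) + v) ^ w - v ^ w))%C by ring.
    rewrite Cmod_mult.
    replace (y ^ w * / 250 * (Cmod (h t) * (1 + (IZR c * t) ^ w)))
      with (Cmod (h t) * (y ^ w * (/ 250 * (1 + (IZR c * t) ^ w)))) by ring.
    apply Rmult_le_compat_l; [apply Cmod_ge_0|].
    eapply Rle_trans; [apply Cmod_pow_diff|]. rewrite Hv, Cmod_imaginary by lra.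
    replace ((t + y) ^ w - y ^ w) with (y ^ w * ((1 + t / y) ^ w - 1)).
    2: { replace (t + y) with (y * (1 + t / y)) by (field; lra). rewrite Rpow_mult_distr. ring. }
    apply Rmult_le_compat_l; [lra|].
    assert (Hct : 0 <= IZR c * t) by (apply Rmult_le_pos; lra).
    assert (His : 0 < / s) by (apply Rinv_0_lt_compat; lra).
    assert (Hty : t / y <= / s * (IZR c * t)).
    { apply (Rmult_le_reg_r y); [exact Hy|]. unfold Rdiv at 1.
      rewrite Rmult_assoc, Rinv_l, Rmult_1_r by lra.
      replace (/ s * (IZR c * t) * y) with (t * (/ s * (IZR c * y))) by ring.
      rewrite <- (Rmult_1_r t) at 1. apply Rmult_le_compat_l; [lra|].
      apply (Rmult_le_compat_l (/ s * IZR c)) in Hfar; [|left; now apply Rmult_lt_0_compat].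
      replace (/ s * IZR c * (s / IZR c)) with 1 in Hfar by (field; lra). lra. }
    assert (Hty0 : 0 <= t / y) by (left; now apply Rdiv_lt_0_compat).
    assert (H1 : (1 + t / y) ^ w <= (1 + / s * (IZR c * t)) ^ w) by (apply pow_incr; lra).
    assert (H2 : / s <= 1) by (rewrite <- Rinv_1; apply Rinv_le_contravar; lra).
    assert (H3 := pow_convex w (/ s) (IZR c * t) ltac:(lra) Hct).
    assert (H4 := pow_1_plus_le w (IZR c * t) Hct).
    apply (Rmult_le_compat_l (/ s)) in H4; [|lra].
    replace (/ s * (2 ^ w * (1 + (IZR c * t) ^ w))) with (/ 250 * (1 + (IZR c * t) ^ w)) in H4
      by (unfold s; field; lra).
    lra. }
  assert (HF0 : absolutely_integrable_pow 0 F).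
  { apply (absolutely_integrable_pow_dominated w 0 h F ((1 + Rabs x + Cmod X) ^ w) h_integrable
        HFp).
    - intros t Ht. unfold F. rewrite Cmod_mult, Cmod_pow. simpl. rewrite Rmult_1_r.
      replace ((1 + Rabs x + Cmod X) ^ w * (Cmod (h t) * (1 + t) ^ w))
        with (Cmod (h t) * ((1 + Rabs x + Cmod X) * (1 + t)) ^ w)
        by (rewrite Rpow_mult_distr; ring).
      apply Rmult_le_compat_l; [apply Cmod_ge_0|]. apply pow_incr. split; [apply Cmod_ge_0|].
      unfold Cminus. eapply Rle_trans; [apply Cmod_triangle|]. rewrite Cmod_opp.
      assert (A := Cmod_vertical_line x t ltac:(lra)). assert (B := Cmod_ge_0 X). nra.
    - apply pow_le. assert (A := Rabs_pos x). assert (B := Cmod_ge_0 X). lra. }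
  destruct (absolutely_integrable_convergence F HF0) as [L [HL Hlim]].
  assert (EL : L = 0) by (rewrite <- (improper_unique _ _ HL); exact (improper_unique _ _ HX)).
  subst L.
  assert (Hsmall : 0 < W * IZR c ^ w * y ^ w) by (now apply Rmult_lt_0_compat).
  (* In units of [W c^w y^w]: the constant power contributes at least [17/1000 - 1/4000], the error
     is at most [4/250 = 16/1000], and the truncated integral of [F] is below [1/4000], a
     contradiction. *)
  destruct (Hlim (W * IZR c ^ w * y ^ w / 4000)) as [d1 [Hd1 Hlim1]]; [lra|].
  destruct (h_integral_lower_bound (W / 4000) ltac:(lra)) as [d2 [Hd2 Hlow]].
  destruct (common_interval d1 d2 Hd1 Hd2) as [e [r [Her [[He1 Hr1] [He2 Hr2]]]]].
  assert (A := Hlim1 e r He1 Hr1). assert (A' := Hlow e r He2 Hr2 (proj2 Her)).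
  assert (IF := pcont_is_CInt F e r HFp ltac:(lra) ltac:(lra)).
  assert (Ih := is_CInt_Cmult (v ^ w)%C _ _ _ _ (pcont_is_CInt h e r h_pcont ltac:(lra)
      ltac:(lra))).
  set (JF := CInt F e r) in *. set (Jh := CInt h e r) in *.
  destruct (scaled_integral_bound (IZR c) e r ltac:(lra) Her) as [IB HB].
  set (JB := RInt _ e r) in *.
  assert (HD := Cmod_CInt_le _ _ e r _ _ (proj2 Her) (fun t Ht => Hdiff t ltac:(lra))
            (is_CInt_minus _ _ _ _ _ _ IF Ih)
            (is_RInt_scal (V := R_NormedModule) _ _ _ (y ^ w * / 250) _ IB)).
  assert (HD' : Cmod (JF - v ^ w * Jh)%C <= y ^ w * / 250 * (2 * W * (IZR c ^ w + IZR c ^ w))).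
  { eapply Rle_trans; [exact HD|]. apply (Rmult_le_compat_l (y ^ w * / 250)); [lra|exact HB]. }
  assert (Htri : Cmod (v ^ w * Jh)%C <= Cmod JF + Cmod (JF - v ^ w * Jh)%C).
  { rewrite <- (Cmod_opp (JF - v ^ w * Jh)%C).
    eapply Rle_trans; [|apply Cmod_triangle]. apply Req_le. f_equal. Cring. }
  rewrite Cmod_mult, Cmod_pow, Hv in Htri.
  assert (A0 : Cmod JF < W * IZR c ^ w * y ^ w / 4000).
  { eapply Rle_lt_trans; [|exact A]. apply Req_le. f_equal. symmetry. Cring. }
  apply (Rmult_le_compat_l (y ^ w)) in A'; [|lra].
  lra.
Qed.

Lemma period_polynomial_value (X L : C) :
  is_CInt_improper (fun t => h t * ((x, t) - X) ^ w)%C L ->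
  period_polynomial (2 * l) f (Mat2 p q c d) X = L.
Proof.
  intros H. unfold period_polynomial, vertical_integral. simpl ma. simpl mc.
  apply improper_unique. revert H. apply improper_ext. intros t. unfold h. fold w x. ring.
Qed.

End RootBound.

Theorem theorem1p6 :
  forall k : nat, (6 <= k)%nat -> Nat.Even k ->
  exists K : R,
  forall (N : nat) (f : C -> C) (a b c d : Z),
    (1 <= N)%nat -> newform N k f ->
    Gamma0 N (Mat2 a b c d) -> (0 < c)%Z ->
    let r := period_polynomial k f (Mat2 a b c d) in
    polynomial_of_degree (k - 2) r /\
    forall x0 : C, r x0 = 0 ->
      Cmod (x0 - RtoC (IZR a / IZR c)) <=
        K * (Rpower (Rabs (IZR a / IZR c) + 1) ((INR k - 4) / (INR k - 2))
             * Rpower (IZR c) (- 2 / (INR k - 2))).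
Proof.
  intros k Hk [l ->].
  exists (250 * 2 ^ (2 * l - 2)).
  intros N f a b c d HN [Hf [_ [Heig [u [Hu Hu1]]]]] Hg Hc r.
  assert (Hl : (3 <= l)%nat) by lia.
  assert (Hval := period_polynomial_value l f a b c d).
  assert (Hzero := no_distant_zero N l f u HN Hl Hf Hu Hu1 Heig a b c d Hg Hc).
  assert (Hint := h_integrable N l f u HN Hl Hf Hu Hu1 Heig a b c d Hg Hc).
  assert (Hneq := h_integral_neq_0 N l f u HN Hl Hf Hu Hu1 Heig a b c d Hg Hc).
  destruct (improper_integral_polynomial _ (IZR a / IZR c) _ Hint) as [p [Hlead Hp]].
  split.
  - exists p. split.
    + intros E. apply (Hneq _ Hlead). rewrite E. ring.
    + intros X. apply Hval, Hp.
  - intros x0 Hx0.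
    (* [r x0 = 0] only gives the value of the total operator [RInt_gen]; convergence to that value
       comes from [Hp]. *)
    assert (Hx0' : sum_n (G := C_AbelianMonoid) (fun j => p j * x0 ^ j)%C (2 * l - 2) = RtoC 0).
    { rewrite <- Hx0. symmetry. apply Hval, Hp. }
    specialize (Hp x0). rewrite Hx0' in Hp.
    assert (H := Hzero x0 Hp).
    assert (Hc1 : 1 <= IZR c) by (apply (IZR_le 1); lia).
    assert (Hk0 : 4 < INR (2 * l)).
    { replace 4 with (INR 4) by (simpl; ring). apply lt_INR. lia. }
    assert (H2 : 0 < 2 ^ (2 * l - 2)) by (apply pow_lt; lra).
    (* From [O(1/c)] to the claim: the first [Rpower] factor is at least 1, and
       [1/c <= c^(-2/(k-2))] because [c >= 1] and [k - 2 > 2]. *)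
    eapply Rle_trans; [left; exact H|].
    unfold Rdiv at 1. apply Rmult_le_compat_l; [lra|].
    rewrite <- (Rmult_1_l (/ IZR c)).
    assert (Hic : 0 < / IZR c) by (apply Rinv_0_lt_compat; lra).
    apply Rmult_le_compat; [lra|lra| |].
    + assert (Hx := Rabs_pos (IZR a / IZR c)).
      apply Rle_trans with (Rpower (Rabs (IZR a / IZR c) + 1) 0); [rewrite Rpower_O; lra|].
      apply Rle_Rpower; [lra|]. left. apply Rdiv_lt_0_compat; lra.
    + rewrite <- (Rpower_1 (IZR c)) at 1 by lra. rewrite <- Rpower_Ropp.
      apply Rle_Rpower; [exact Hc1|].
      apply (Rmult_le_reg_r (INR (2 * l) - 2)); [lra|].
      replace (- 2 / (INR (2 * l) - 2) * (INR (2 * l) - 2)) with (- 2) by (field; lra). lra.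
Qed.
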